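(* There exist absolute constants $\alpha_0>0$ and $\beta_0>0$ such that the following holds in the binary classification setting described in the context (with margin $h$ and with $\mathcal{L}_1$, $\mathcal{L}_2$ independent). Consider a penalty function of the form: for all $M\in\mathcal{P}(\Lambda)$ and all $T\preceq T_{max}^{(M)}$, $$pen(M,T)=\alpha\frac{|T|}{n_2h}+\beta\frac{|M|}{n_2h}\left(1+\log\left(\frac{p}{|M|}\right)\right).$$ If $\alpha>\alpha_0$ and $\beta>\beta_0$, then there exist two positive constants $C_1>1$ and $C_2$, which depend only on $\alpha$ and $\beta$, such that the penalized estimator $\tilde s=\hat s_{\widehat{(M,T)}}$ satisfies $$\mathbb{E}\big[l(s,\tilde s)\mid\mathcal{L}_1\big]\le C_1\inf_{(M,T)}\big\{l(s,S_{M,T})+pen(M,T)\big\}+C_2\frac{1}{n_2h},$$ where $l(s,S_{M,T})=\inf_{u\in S_{M,T}}l(s,u)$ and the infimum is over all $M\in\mathcal{P}(\Lambda)$ and $T\preceq T_{max}^{(M)}$.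
   Context: Setting. $(X,Y)$ is a random pair with $X=(X^1,\dots,X^p)\in\mathbb{R}^p$ and $Y\in\{0,1\}$; $\mu$ is the law of $X$; $\eta(x)=\mathbb{E}[Y\mid X=x]$; the Bayes classifier is $s(x)=\mathbf{1}_{\eta(x)\ge 1/2}$. For $u:\mathbb{R}^p\to\{0,1\}$, $\gamma(u,(x,y))=(y-u(x))^2=\mathbf{1}_{u(x)\ne y}$, and the loss is $l(s,u)=\mathbb{E}[\gamma(u,(X,Y))]-\mathbb{E}[\gamma(s,(X,Y))]=\mathbb{P}(Y\neq u(X))-\mathbb{P}(Y\neq s(X))$; for a data-dependent $\tilde s$, $l(s,\tilde s)$ is the functional $l(s,\cdot)$ evaluated at $\tilde s$. Margin condition: there is $h>0$ with $|2\eta(x)-1|\ge h$ for all $x\in\mathbb{R}^p$. Samples (case (M1)). The training sample of independent copies of $(X,Y)$ is split into independent subsamples $\mathcal{L}_1,\mathcal{L}_2,\mathcal{L}_3$ of sizes $n_1,n_2,n_3$. Models. $\Lambda=\{X^1,\dots,X^p\}$ is the set of explanatory variables and $\mathcal{P}(\Lambda)$ the collection of its (nonempty) subsets $M$, $|M|$ being the cardinality. For each $M$, $T_{max}^{(M)}$ is the maximal binary tree built by the CART growing procedure from $\mathcal{L}_1$, using only admissible splits (questions $X^j\le c$) on variables $X^j\in M$: starting from the root $\mathbb{R}^p$, nodes are recursively split in two by the admissible split maximizing the decrease of an impurity function (e.g. the Gini index), until each terminal node contains one observation or observations with the same response. $T\preceq T_{max}^{(M)}$ means that $T$ is a pruned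 subtree (same root, obtained by cutting branches); $|T|$ is its number of leaves and $\tilde T$ is the partition of $\mathbb{R}^p$ given by its leaves. $S_{M,T}$ is the set of $\{0,1\}$-valued functions that are constant on each element of $\tilde T$. $\gamma_{n_2}(u)=\frac1{n_2}\sum_{(X_i,Y_i)\in\mathcal{L}_2}(Y_i-u(X_i))^2$, and $\hat s_{M,T}$ is a minimizer of $\gamma_{n_2}$ over $S_{M,T}$. The selected model $\widehat{(M,T)}$ minimizes $\gamma_{n_2}(\hat s_{M,T})+pen(M,T)$ over all $M\in\mathcal{P}(\Lambda)$, $T\preceq T_{max}^{(M)}$, and $\tilde s=\hat s_{\widehat{(M,T)}}$. *)

(* Defs.v *)
From HB Require Import structures.
From mathcomp Require Import all_boot all_order all_algebra.
From mathcomp Require Import all_classical all_reals all_analysis.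

Set Implicit Arguments.
Unset Strict Implicit.
Unset Printing Implicit Defensive.

Import Order.TTheory GRing.Theory Num.Theory.

Local Open Scope classical_set_scope.
Local Open Scope ring_scope.

Section Probability.
Context {d : measure_display} {Omega : measurableType d} {R : realType}.
Variable P : probability Omega R.

Definition independent_family {d' : measure_display} {T : measurableType d'}
    {I : finType} (D : I -> Omega -> T) : Prop :=
  forall B : I -> set T, (forall i, measurable (B i)) ->
    P (\bigcap_i (D i @^-1` B i)) = (\prod_i P (D i @^-1` B i))%E.

Definition same_law {d' : measure_display} {T : measurableType d'}
    (V W : Omega -> T) : Prop :=
  forall B : set T, measurable B -> P (V @^-1` B) = P (W @^-1` B).

(* W is a version of E[Z | V], i.e. of the conditional expectation of Z given
   the sigma-algebra generated by V; such a W exists as soon as Z is integrable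
   (Radon-Nikodym) and is unique up to a P-negligible set. *)
Definition is_cond_exp {d' : measure_display} {T : measurableType d'}
    (V : Omega -> T) (Z W : Omega -> R) : Prop :=
  [/\ P.-integrable setT (EFin \o Z),
      P.-integrable setT (EFin \o W),
      forall B : set R, measurable B ->
        g_sigma_algebra_preimage V (W @^-1` B) &
      forall A : set Omega, g_sigma_algebra_preimage V A ->
        (\int[P]_(w in A) (W w)%:E = \int[P]_(w in A) (Z w)%:E)%E].

End Probability.

Definition is_argmin {A : Type} {R : realType} (S : set A) (f : A -> R)
    (a : A) : Prop :=
  S a /\ forall b, S b -> f a <= f b.

Section Trees.
Context {R : realType} {p : nat}.

(* Node j c l r carries the question "X^j <= c": l is the branch for the
   answer yes, r the branch for the answer no. *)
Inductive ctree : Type :=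
| Leaf : ctree
| Node : 'I_p -> R -> ctree -> ctree -> ctree.

Fixpoint nleaves (t : ctree) : nat :=
  match t with
  | Leaf => 1
  | Node _ _ l r => nleaves l + nleaves r
  end.

Fixpoint cells_in (A : set (p.-tuple R)) (t : ctree) :
    seq (set (p.-tuple R)) :=
  match t with
  | Leaf => [:: A]
  | Node j c l r =>
      cells_in (A `&` [set x | tnth x j <= c]) l ++
      cells_in (A `&` [set x | c < tnth x j]) r
  end.

Definition leaf_partition (t : ctree) : seq (set (p.-tuple R)) :=
  cells_in setT t.

Definition classifiers (t : ctree) : set (p.-tuple R -> bool) :=
  [set u | forall C, C \in leaf_partition t ->
           forall x y, C x -> C y -> u x = u y].

Inductive pruned : ctree -> ctree -> Prop :=
| pruned_cut t : pruned Leaf t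
| pruned_node j c l r l' r' :
    pruned l l' -> pruned r r' -> pruned (Node j c l r) (Node j c l' r').

(* Question asked at the node of address a (true = yes branch), if that node
   exists and is not a leaf. *)
Fixpoint question (t : ctree) (a : seq bool) : option ('I_p * R) :=
  match t, a with
  | Leaf, _ => None
  | Node j c _ _, [::] => Some (j, c)
  | Node _ _ l r, b :: a' => question (if b then l else r) a'
  end.

(* Measurability for the sigma-algebra on trees generated by the variables and
   the thresholds of the questions. *)
Definition measurable_tree {d : measure_display} {T : measurableType d}
    (f : T -> ctree) : Prop :=
  forall (a : seq bool) (j : 'I_p) (b : R),
    measurable [set z | exists2 c, question (f z) a = Some (j, c) & c <= b].

End Trees.

Arguments ctree R p : clear implicits.

Notation obs R p := (p.-tuple R * bool)%type.

Section Cart.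
Context {R : realType} {p : nat}.

(* Two-class impurity function, as a function of the proportion q of one of
   the classes; e.g. the Gini index q |-> 2 * q * (1 - q). *)
Definition impurity_function (phi : R -> R) : Prop :=
  [/\ forall q, 0 <= q <= 1 -> phi (1 - q) = phi q,
      forall q, 0 <= q <= 1 -> q != 2^-1 -> phi q < phi 2^-1 &
      forall q, 0 < q < 1 -> phi 0 < phi q].

Variable phi : R -> R.

Definition yes_part (j : 'I_p) (c : R) (s : seq (obs R p)) : seq (obs R p) :=
  [seq z <- s | tnth z.1 j <= c].

Definition no_part (j : 'I_p) (c : R) (s : seq (obs R p)) : seq (obs R p) :=
  [seq z <- s | c < tnth z.1 j].

Definition impurity (s : seq (obs R p)) : R :=
  phi ((count (fun z => z.2) s)%:R / (size s)%:R).

Definition decrease (s : seq (obs R p)) (j : 'I_p) (c : R) : R :=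
  impurity s
  - (size (yes_part j c s))%:R / (size s)%:R * impurity (yes_part j c s)
  - (size (no_part j c s))%:R / (size s)%:R * impurity (no_part j c s).

(* A question that leaves one of the two children without observation does not
   split the node. *)
Definition admissible (M : {set 'I_p}) (s : seq (obs R p)) (j : 'I_p) (c : R) : bool :=
  [&& j \in M, (0 < size (yes_part j c s))%N & (0 < size (no_part j c s))%N].

(* The last case only arises when observations with distinct responses have the
   same coordinates in M, so that no question on M separates them. *)
Definition terminal (M : {set 'I_p}) (s : seq (obs R p)) : Prop :=
  [\/ (size s <= 1)%N, constant [seq z.2 | z <- s] |
      forall j c, ~~ admissible M s j c].

Inductive maximal_tree (M : {set 'I_p}) : seq (obs R p) -> ctree R p -> Prop :=
| maximal_leaf s : terminal M s -> maximal_tree M s Leaf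
| maximal_node s j c l r :
    ~ terminal M s ->
    admissible M s j c ->
    (forall j' c', admissible M s j' c' -> decrease s j' c' <= decrease s j c) ->
    maximal_tree M (yes_part j c s) l ->
    maximal_tree M (no_part j c s) r ->
    maximal_tree M s (Node j c l r).

End Cart.

Section Selection.
Context {R : realType} {p : nat}.

Definition contrast (u : p.-tuple R -> bool) (z : obs R p) : R :=
  (z.2%:R - (u z.1)%:R) ^+ 2.

Definition bayes (eta : p.-tuple R -> R) : p.-tuple R -> bool :=
  fun x => 2^-1 <= eta x.

Definition loss {d : measure_display} {Omega : measurableType d}
    (P : probability Omega R) (X : Omega -> p.-tuple R) (Y : Omega -> bool)
    (s u : p.-tuple R -> bool) : R :=
  fine ('E_P[fun w => contrast u (X w, Y w)])%E
  - fine ('E_P[fun w => contrast s (X w, Y w)])%E.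

Definition empirical_contrast {n : nat} (l : n.-tuple (obs R p))
    (u : p.-tuple R -> bool) : R :=
  n%:R^-1 * \sum_(i < n) contrast u (tnth l i).

Definition models (Tmax : {set 'I_p} -> ctree R p) :
    set ({set 'I_p} * ctree R p) :=
  [set MT : {set 'I_p} * ctree R p | (0 < #|MT.1|)%N /\ pruned MT.2 (Tmax MT.1)].

Definition pen (alpha beta h : R) (n : nat) (MT : {set 'I_p} * ctree R p) : R :=
  alpha * ((nleaves MT.2)%:R / (n%:R * h))
  + beta * (#|MT.1|%:R / (n%:R * h)) * (1 + ln (p%:R / #|MT.1|%:R)).

End Selection.

(* Main.v *)
Require Import Defs.
From HB Require Import structures.
From mathcomp Require Import all_boot all_order all_algebra.
From mathcomp Require Import all_classical all_reals all_analysis.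
From mathcomp Require Import measurable_realfun ring lra.

Set Implicit Arguments.
Unset Strict Implicit.
Unset Printing Implicit Defensive.

Import Order.TTheory GRing.Theory Num.Theory.

Local Open Scope classical_set_scope.
Local Open Scope ring_scope.

(** Given the first subsample, the class S_(M,T) of a tree with k leaves is
    finite: it has at most 2^k elements.  A union bound over all candidate
    classifiers therefore suffices, provided that each of them satisfies an
    exponential inequality of the right order, and the margin condition provides
    it.  The contrasts of u and of the Bayes classifier s differ only where
    u(X) <> s(X), and h P(u(X) <> s(X)) <= l(s,u) (margin_le_loss): the variance
    of the excess contrast is bounded by its mean divided by h.  Hence, in the
    exponential moment of -(h/4) times the excess contrast, the quadratic term
    eats only half of the linear one (expR_margin_le):
      E exp (h/8 l(s,u) - h/4 (contrast u - contrast s)) <= 1.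
    Multiplying over the n independent points of the second subsample, the
    variable xi_u = l(s,u) - 2 (empirical excess contrast of u) - 2 pen
    satisfies E exp (n h/8 xi_u) <= exp (- n h/4 pen).  The penalty is calibrated so that
    these bounds add up to at most 1 over all u, M and T (sum_weight_le): the
    term in |T| pays for the shapes of the subtrees and for the labels of their
    leaves, whose numbers grow geometrically, and the term in |M| pays for the
    binomial coefficients, which are at most (e p/m)^m.  As x <= exp x,
    the expectation of the largest xi_u is at most 8/(n h).  The definition of
    the selected model bounds its penalized empirical excess contrast by that of
    any competitor, whose mean is a loss plus a penalty; this gives the oracle
    inequality with C1 = 2 and C2 = 8.

    The classes depend on the first subsample, so the conditional argument
    needs an indexing that does not.  Classifiers are indexed by a set M and a
    binary tree whose leaves carry labels; such a tree is read along the
    questions of the maximal tree (lclass).  Every function of every S_(M,T) is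
    reached in this way with as many leaves as T, each index gives a
    jointly measurable function of the first subsample and of the point, and the
    maximal tree on n1 observations has depth at most n1, so finitely many
    indices suffice.  Independence of the two subsamples then takes the form of
    Fubini's theorem (integral_subsample, integral_prod_subsample_le).  The
    conditional expectation is handled by integrating over the events
    {L1 in B}: comparing integrals over all of them for each fixed competitor
    gives an almost sure inequality (ae_le_comp), and the infimum is taken
    afterwards over finitely many competitors. *)

(** * Labelled trees and the classifiers they encode *)

(** A shape of pruned subtree together with the labels of its leaves, without
    the questions: the questions are those of a maximal tree supplied later, so
    that the same index makes sense for every training sample. *)
Inductive ltree : Type :=
| LLeaf : bool -> ltree
| LNode : ltree -> ltree -> ltree.

HB.instance Definition _ := gen_eqMixin ltree.

Fixpoint lleaves (t : ltree) : nat :=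
  match t with
  | LLeaf _ => 1
  | LNode a b => lleaves a + lleaves b
  end.

Lemma lleaves_gt0 a : (0 < lleaves a)%N.
Proof. by elim: a => //= a a0 b _; rewrite addn_gt0 a0. Qed.

(** Labelled trees of depth at most N. *)
Fixpoint ltrees (N : nat) : seq ltree :=
  [:: LLeaf true; LLeaf false] ++
  (if N is N'.+1 then [seq LNode a b | a <- ltrees N', b <- ltrees N'] else [::]).

Lemma LLeaf_ltrees N b : LLeaf b \in ltrees N.
Proof. by case: N b => [|N] [] /=; rewrite !inE eqxx ?orbT. Qed.

Lemma LNode_ltrees N a b : a \in ltrees N -> b \in ltrees N ->
  LNode a b \in ltrees N.+1.
Proof. by move=> aN bN; rewrite mem_cat; apply/orP; right; exact: allpairs_f. Qed.

Section LabelledClassifiers.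
Context {R : realType} {p : nat}.
Implicit Types (t : ctree R p) (x : p.-tuple R) (A C : set (p.-tuple R)).

(** The labelled tree is read along the questions of t.  If t stops before the
    labelled tree does, the answer is false, a value chosen so that
    every labelled tree yields a classifier of some pruned subtree of t. *)
Fixpoint lclass (a : ltree) t x : bool :=
  match a, t with
  | LLeaf b, _ => b
  | LNode a1 a2, Node j c l r =>
      if tnth x j <= c then lclass a1 l x else lclass a2 r x
  | LNode _ _, Leaf => false
  end.

Fixpoint depth t : nat :=
  match t with
  | Leaf => 0
  | Node _ _ l r => (maxn (depth l) (depth r)).+1
  end.

Lemma cells_in_sub A t C : C \in cells_in A t -> C `<=` A.
Proof.
elim: t A => [|j c l IHl r IHr] A /=; first by rewrite inE => /eqP ->.
by rewrite mem_cat => /orP[/IHl|/IHr] CA x /CA[].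
Qed.

(** The statement is relative to a region A because the induction goes down to
    the children of the root, whose cells are cut out of half-spaces. *)
Lemma pruned_lclass N t t' A (u : p.-tuple R -> bool) :
  pruned t' t -> (depth t <= N)%N ->
  (forall C, C \in cells_in A t' -> forall x y, C x -> C y -> u x = u y) ->
  exists2 a, a \in ltrees N &
    lleaves a = nleaves t' /\ forall x, A x -> u x = lclass a t x.
Proof.
move=> tt'; elim: tt' N A => {t t'} [t|j c l r l' r' _ IHl _ IHr] N A dN uC.
  (* an empty cell may carry any label *)
  have [[y Ay]|A0] := pselect (A !=set0).
    exists (LLeaf (u y)); first exact: LLeaf_ltrees.
    by split=> // x Ax; apply: (uC A) => //; rewrite inE.
  exists (LLeaf true); first exact: LLeaf_ltrees.
  by split=> // x Ax; case: A0; exists x.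
case: N dN => // N /=; rewrite ltnS geq_max => /andP[lN rN].
have [|a1 a1N [la1 ua1]] := IHl N (A `&` [set x | tnth x j <= c]) lN.
  by move=> C Cl; apply: uC; rewrite /= mem_cat Cl.
have [|a2 a2N [la2 ua2]] := IHr N (A `&` [set x | c < tnth x j]) rN.
  by move=> C Cr; apply: uC; rewrite /= mem_cat Cr orbT.
exists (LNode a1 a2); first exact: LNode_ltrees.
split=> [|x Ax]; first by rewrite /= la1 la2.
rewrite /=; case: leP => xc; first by apply: ua1; split.
by apply: ua2; split.
Qed.

Lemma classifiers_lclass N t t' (u : p.-tuple R -> bool) :
  pruned t' t -> (depth t <= N)%N -> classifiers t' u ->
  exists2 a, a \in ltrees N & lleaves a = nleaves t' /\ u = lclass a t.
Proof.
move=> tt' tN /(pruned_lclass tt' tN)[a aN [la ua]].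
by exists a => //; split=> //; apply/funext => x; exact: ua.
Qed.

Lemma lclass_pruned_in a t A : exists t',
  [/\ pruned t' t, (nleaves t' <= lleaves a)%N &
   forall C, C \in cells_in A t' -> forall x y, C x -> C y ->
     lclass a t x = lclass a t y].
Proof.
elim: a t A => [b|a1 IH1 a2 IH2] t A.
  by exists Leaf; split=> //; exact: pruned_cut.
case: t => [|j c l r].
  exists Leaf; split=> //=; first exact: pruned_cut.
  by rewrite addn_gt0 lleaves_gt0.
have [l' [pl nl cl]] := IH1 l (A `&` [set x | tnth x j <= c]).
have [r' [pr nr cr]] := IH2 r (A `&` [set x | c < tnth x j]).
exists (Node j c l' r'); split=> [||C /=]; first exact: pruned_node.
  exact: leq_add.
rewrite mem_cat => /orP[] CC x y Cx Cy.
  have [_ /= ->] := cells_in_sub CC Cx; have [_ /= ->] := cells_in_sub CC Cy.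
  exact: cl CC _ _ Cx Cy.
have [_ /=] := cells_in_sub CC Cx; have [_ /=] := cells_in_sub CC Cy.
rewrite !ltNge => /negbTE -> /negbTE ->.
exact: cr CC _ _ Cx Cy.
Qed.

(** Converse of classifiers_lclass up to the number of leaves: any labelled
    tree may serve as a competitor, whether or not its shape fits in t. *)
Lemma lclass_classifiers a t : exists t',
  [/\ pruned t' t, (nleaves t' <= lleaves a)%N & classifiers t' (lclass a t)].
Proof. exact: lclass_pruned_in. Qed.

(** An admissible question leaves observations on both sides, so the number of
    observations decreases along each branch. *)
Lemma depth_maximal_tree phi M (s : seq (obs R p)) t :
  maximal_tree phi M s t -> (depth t <= size s)%N.
Proof.
elim=> // {}s j c l r _ /and3P[_ y0 n0] _ _ IHl _ IHr /=.
have sE : size s = (size (yes_part j c s) + size (no_part j c s))%N.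
  rewrite !size_filter -(count_predC (fun z => tnth z.1 j <= c) s).
  by congr (_ + _)%N; apply: eq_count => z /=; rewrite ltNge.
rewrite gtn_max sE -addn1; apply/andP; split.
  by rewrite -addn1; exact: leq_add.
by rewrite addnC -addn1; exact: leq_add.
Qed.

End LabelledClassifiers.

(** * Sums of weights over labelled trees and over sets of variables *)

Section Weights.
Context {R : realType}.

(** Split at the root, the sum S for depth N gives 2 y + S ^ 2 for depth N + 1,
    and the bound 4 y is preserved when y <= 1/8. *)
Lemma sum_ltrees_le (y : R) N : 0 <= y -> y <= 8^-1 ->
  \sum_(a <- ltrees N) y ^+ lleaves a <= 4 * y.
Proof.
move=> y0 y8; elim: N => [|N IH] /=.
  by rewrite !big_cons big_nil /= expr1; lra.
rewrite !big_cons /= big_allpairs_dep /= expr1.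
set S := \sum_(a <- ltrees N) _ in IH.
have S0 : 0 <= S by apply: sumr_ge0 => a _; exact: exprn_ge0.
rewrite (_ : \sum_(i <- _) _ = S * S); first by nra.
rewrite mulr_suml; apply: eq_bigr => a _.
by rewrite mulr_sumr; apply: eq_bigr => b _; rewrite exprD.
Qed.

Lemma expn_le_fact m : (m%:R : R) ^+ m <= expR 1 ^+ m * (m`!)%:R.
Proof.
elim: m => [|m IH]; first by rewrite !expr0 mul1r.
have [->|m0] := eqVneq m 0%N.
  by rewrite !expr1 mulr1 (le_trans _ (expR_ge1Dx 1))// lerDl.
have mR : 0 < (m%:R : R) by rewrite ltr0n lt0n.
have E : (m.+1%:R : R) ^+ m <= expR 1 * m%:R ^+ m.
  rewrite -ler_pdivrMr ?exprn_gt0// -expr_div_n.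
  have -> : (m.+1%:R / m%:R : R) = 1 + m%:R^-1.
    by rewrite -natr1 mulrDl mul1r divff ?gt_eqF.
  apply: (@le_trans _ _ (expR m%:R^-1 ^+ m)).
    by rewrite lerXn2r ?nnegrE ?expR_ge0 ?expR_ge1Dx// addr_ge0 // invr_ge0 ltW.
  by rewrite -expRM_natl mulfV ?gt_eqF.
rewrite exprS factS natrM [leRHS](_ : _ = m.+1%:R * (expR 1 * (expR 1 ^+ m * m`!%:R))).
  rewrite ler_wpM2l //; apply: le_trans E _; rewrite ler_wpM2l // expR_ge0 //.
by rewrite exprS; ring.
Qed.

(** The right-hand side is (e p / m) ^ m; the falling factorial is at most p ^ m,
    and (m / e) ^ m <= m! by expn_le_fact. *)
Lemma bin_le_expR p m : (0 < m <= p)%N ->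
  ('C(p, m))%:R <= expR (m%:R * (1 + ln (p%:R / m%:R))) :> R.
Proof.
case/andP=> m0 mp.
have mR : 0 < (m%:R : R) by rewrite ltr0n.
have pR : 0 < (p%:R : R) by rewrite ltr0n (leq_trans m0).
rewrite expRM_natl expRD lnK ?posrE ?divr_gt0// exprMn expr_div_n mulrA.
rewrite ler_pdivlMr ?exprn_gt0//.
apply: (@le_trans _ _ ('C(p, m)%:R * (expR 1 ^+ m * m`!%:R))).
  by rewrite ler_wpM2l// expn_le_fact.
rewrite mulrCA ler_wpM2l ?exprn_ge0 ?expR_ge0// -natrM bin_ffact -natrX ler_nat.
rewrite ffact_prod -[X in (_ <= _ ^ X)%N]card_ord -prod_nat_const.
by apply: leq_prod => i _; exact: leq_subr.
Qed.

(** Half of the exponent compensates the number of sets of each cardinal m, and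
    the other half leaves at most exp (- m) <= 2 ^ (- m). *)
Lemma sum_subsets_le p (b : R) : 2 <= b ->
  \sum_(M : {set 'I_p} | (0 < #|M|)%N)
    expR (- (b * (#|M|%:R * (1 + ln (p%:R / #|M|%:R))))) <= 1.
Proof.
move=> b2.
pose g m : R := expR (- (b * (m%:R * (1 + ln (p%:R / m%:R))))).
have cardP (M : {set 'I_p}) : (#|M| < p.+1)%N.
  by rewrite ltnS -[X in (_ <= X)%N](card_ord p) max_card.
rewrite (partition_big (fun M => Ordinal (cardP M)) predT) //=.
apply: (@le_trans _ _ (\sum_(m < p.+1 | (0 < m)%N) 2^-1 ^+ m)).
  rewrite [leRHS]big_mkcond; apply: ler_sum => m _.
  case: ifPn => [m0|]; last first.
    rewrite -eqn0Ngt => /eqP m0; rewrite big1 // => M /andP[M0 /eqP Mm].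
    have cM : #|M| = m :> nat by rewrite -Mm.
    by rewrite cM m0 in M0.
  have mp : (m <= p)%N by rewrite -ltnS.
  rewrite (_ : \sum_(i | _) _ = 'C(p, m)%:R * g m).
    have mR : 0 < (m%:R : R) by rewrite ltr0n.
    have L0 : 0 <= ln (p%:R / m%:R) :> R.
      by rewrite ln_ge0// ler_pdivlMr// mul1r ler_nat.
    pose x := m%:R * (1 + ln (p%:R / m%:R)) : R.
    apply: (@le_trans _ _ (expR x * g m)).
      by rewrite ler_wpM2r ?expR_ge0// bin_le_expR// m0.
    have x0 : m%:R <= x by rewrite /x mulrDr mulr1 lerDl mulr_ge0// ltW.
    rewrite /g -/x -expRD; apply: (@le_trans _ _ (expR (- m%:R))).
      rewrite ler_expR; nra.
    rewrite -(mulr1 m%:R) -mulrN expRM_natl lerXn2r ?nnegrE ?expR_ge0 ?invr_ge0//.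
    rewrite expRN lef_pV2 ?posrE ?expR_gt0//.
    by rewrite (le_trans _ (expR_ge1Dx 1)).
  have cp : 'C(p, m) = #|finset (fun A : {set 'I_p} => #|A| == m)|.
    by rewrite card_draws card_ord.
  rewrite cp -[X in X * _]sumr_const mulr_suml.
  rewrite (eq_bigl (mem (finset (fun A : {set 'I_p} => #|A| == m)))).
    by apply: eq_bigr => M /=; rewrite finset.in_set => /eqP Mm; rewrite mul1r /g Mm.
  move=> M /=; rewrite finset.in_set -val_eqE /= andbC; case: eqP => // ->.
  by rewrite m0.
rewrite big_mkcond big_ord_recl /= add0r.
have gs n : \sum_(i < n) 2^-1 ^+ i.+1 = 1 - 2^-1 ^+ n :> R.
  elim: n => [|n IH]; first by rewrite big_ord0 subrr.
  by rewrite big_ord_recr /= IH exprS; lra.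
rewrite (eq_bigr (fun i : 'I_p => 2^-1 ^+ i.+1)) // gs.
by rewrite gerBl exprn_ge0 // invr_ge0.
Qed.

End Weights.

(** * Joint measurability in the training sample and the point *)

Section LabelledClassifiersMeasurable.
Context {R : realType} {p : nat} {d : measure_display} {T : measurableType d}.
Implicit Types f : T -> ctree R p.

Definition branch (b : bool) (t : ctree R p) : ctree R p :=
  match t with
  | Leaf => Leaf
  | Node _ _ l r => if b then l else r
  end.

Lemma measurable_branch b f :
  measurable_tree f -> measurable_tree (branch b \o f).
Proof.
move=> mf a j c; have := mf (b :: a) j c.
rewrite (_ : (fun z => _) = (fun z => exists2 c0,
  question ((branch b \o f) z) a = Some (j, c0) & c0 <= c)) //.
by apply/funext => z /=; case: (f z).
Qed.

(** A rational number is inserted between the random threshold and the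
    coordinate, which turns the event into a countable union of rectangles. *)
Lemma measurable_root_no f j : measurable_tree f ->
  measurable [set zx : T * p.-tuple R |
    exists2 c, question (f zx.1) [::] = Some (j, c) & c < tnth zx.2 j].
Proof.
move=> mf; rewrite (_ : mkset _ = \bigcup_(r : rat)
    ([set z | exists2 c, question (f z) [::] = Some (j, c) & c <= ratr r] `*`
     [set x | ratr r < tnth x j])).
  apply: bigcupT_measurable_rat => r; apply: measurableX; first exact: mf.
  have := @measurable_tnth _ (measurableTypeR R) p j measurableT _
    (measurable_itv `]ratr r, +oo[).
  rewrite setTI; congr measurable; apply/seteqP.
  by split=> x /=; rewrite in_itv /= andbT.
apply/seteqP; split=> [[z x] /= [c fc cx]|[z x] /= [r _ [[c fc cr] /= rx]]].
  have [r] := rat_in_itvoo cx; rewrite in_itv /= => /andP[cr rx].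
  by exists r => //; split=> //=; exists c => //; exact: ltW.
by exists c => //; exact: le_lt_trans cr rx.
Qed.

Lemma measurable_root_yes f j : measurable_tree f ->
  measurable [set zx : T * p.-tuple R |
    exists2 c, question (f zx.1) [::] = Some (j, c) & tnth zx.2 j <= c].
Proof.
move=> mf; rewrite (_ : mkset _ =
  ((\bigcup_(n : nat)
    [set z | exists2 c, question (f z) [::] = Some (j, c) & c <= n%:R]) `*` setT)
  `\` [set zx : T * p.-tuple R |
    exists2 c, question (f zx.1) [::] = Some (j, c) & c < tnth zx.2 j]).
  apply: measurableD; last exact: measurable_root_no.
  by apply: measurableX => //; apply: bigcupT_measurable => n; exact: mf.
apply/seteqP; split=> [[z x] /= [c fc xc]|[z x] /= [[[n _ [c fc _]] _] nx]].
  split.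
    split=> //; exists (Num.Def.truncn `|c|).+1 => //=; exists c => //.
    by rewrite (le_trans (ler_norm _))// ltW// truncnS_gt.
  by case=> c'; rewrite fc => -[<-]; rewrite ltNge xc.
by exists c => //; rewrite leNgt; apply/negP => cx; apply: nx; exists c.
Qed.

Lemma measurable_lclass a f : measurable_tree f ->
  measurable_fun [set: T * p.-tuple R] (fun zx => lclass a (f zx.1) zx.2).
Proof.
elim: a f => [b|a1 IH1 a2 IH2] f mf; first exact: measurable_cst.
apply: (@measurable_fun_bool _ _ _ _ true); rewrite setTI.
have m1 := IH1 _ (measurable_branch true mf) measurableT [set true] I.
have m2 := IH2 _ (measurable_branch false mf) measurableT [set true] I.
rewrite !setTI in m1 m2.
rewrite (_ : _ @^-1` _ = \bigcup_(j in [set: 'I_p])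
  (([set zx : T * p.-tuple R |
      exists2 c, question (f zx.1) [::] = Some (j, c) & tnth zx.2 j <= c] `&`
     [set zx | lclass a1 (branch true (f zx.1)) zx.2]) `|`
   ([set zx : T * p.-tuple R |
      exists2 c, question (f zx.1) [::] = Some (j, c) & c < tnth zx.2 j] `&`
     [set zx | lclass a2 (branch false (f zx.1)) zx.2]))).
  apply: fin_bigcup_measurable => [|j _]; first exact: finite_finset.
  apply: measurableU; apply: measurableI => //.
    exact: measurable_root_yes.
  exact: measurable_root_no.
apply/seteqP; split=> [[z x] /=|[z x] /= [j _]].
  case fz: (f z) => [//|j c l r].
  by case: leP => xc u; exists j => //=; [left|right]; rewrite fz; split=> //;
    exists c.
case=> /= -[[c]]; case: (f z) => [//|j' c' l r] /= [<- <-].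
  by move=> ->.
by rewrite ltNge => /negbTE ->.
Qed.

End LabelledClassifiersMeasurable.

(** * Independence as Fubini's theorem *)

Section Freezing.
Context {d : measure_display} {Omega : measurableType d} {R : realType}.
Variable P : probability Omega R.

Lemma integral_indep d1 d2 (T1 : measurableType d1) (T2 : measurableType d2)
    (V : {RV P >-> T1}) (Z Z' : {RV P >-> T2}) (f : T1 * T2 -> \bar R) :
  same_law P Z Z' ->
  (forall A B, measurable A -> measurable B ->
    P (V @^-1` A `&` Z @^-1` B) = (P (V @^-1` A) * P (Z @^-1` B))%E) ->
  measurable_fun setT f -> (forall x, 0 <= f x)%E ->
  (\int[P]_w f (V w, Z w) = \int[P]_w \int[P]_w' f (V w, Z' w'))%E.
Proof.
move=> sZ indVZ mf f0.
have mVZ : measurable_fun setT (fun w => (V w, Z w)).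
  by apply/measurable_fun_pairP; split; exact: measurable_funP.
pose VZ : {RV P >-> (T1 * T2)%type} :=
  HB.pack (fun w => (V w, Z w)) (isMeasurableFun.Build _ _ _ _ _ mVZ).
have -> : (\int[P]_w f (V w, Z w) = \int[distribution P VZ]_z f z)%E.
  by rewrite ge0_integral_distribution.
transitivity (\int[distribution P V \x distribution P Z']_z f z)%E.
  apply: eq_measure_integral => A mA _; apply/esym.
  apply: product_measure_unique => // B C mB mC.
  rewrite -[RHS]/(P (V @^-1` B) * P (Z' @^-1` C))%E -sZ // -indVZ //.
rewrite fubini_tonelli1// ge0_integral_distribution //=.
- apply: eq_integral => w _ /=; rewrite /fubini_F.
  rewrite ge0_integral_distribution //.
  by apply: measurableT_comp => //; exact: measurable_pair1.
- exact: measurable_fun_fubini_tonelli_F.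
- by move=> v; apply: integral_ge0 => z _; exact: f0.
Qed.

Lemma measurable_integral_rv d1 d2 (T1 : measurableType d1)
    (T2 : measurableType d2) (Z : {RV P >-> T2}) (f : T1 * T2 -> \bar R) :
  measurable_fun setT f -> (forall x, 0 <= f x)%E ->
  measurable_fun setT (fun v => \int[P]_w f (v, Z w))%E.
Proof.
move=> mf f0.
rewrite (_ : (fun v => _) = fubini_F (distribution P Z) f).
  exact: measurable_fun_fubini_tonelli_F.
apply/funext => v; rewrite /fubini_F ge0_integral_distribution//.
by apply: measurableT_comp => //; exact: measurable_pair1.
Qed.

End Freezing.

Section Independence.
Context {d : measure_display} {Omega : measurableType d} {R : realType}.
Variable P : probability Omega R.
Context {d' : measure_display} {T : measurableType d'} {J : finType}.
Variable D : J -> {RV P >-> T}.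

(** The observation of index i0 is replaced by a constant, so that the tuple
    is independent of D i0 and still determines every subsample that omits i0. *)
Definition others_fun (i0 : J) (w : Omega) : #|J|.-tuple T :=
  [tuple if enum_val i == i0 then point else D (enum_val i) w | i < #|J|].

Lemma measurable_others i0 : measurable_fun setT (others_fun i0).
Proof.
apply/measurable_fun_tnthP => i.
have [ii0|ii0] := eqVneq (enum_val i) i0.
  rewrite (_ : _ \o _ = cst point); first exact: measurable_cst.
  by apply/funext => w /=; rewrite tnth_mktuple ii0 eqxx.
rewrite (_ : _ \o _ = D (enum_val i)); first exact: measurable_funP.
by apply/funext => w /=; rewrite tnth_mktuple (negbTE ii0).
Qed.

HB.instance Definition _ i0 :=
  isMeasurableFun.Build _ _ _ _ (others_fun i0) (measurable_others i0).

Definition others (i0 : J) : {RV P >-> #|J|.-tuple T} := others_fun i0.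

Lemma tnth_others i0 i w : i != i0 -> tnth (others i0 w) (enum_rank i) = D i w.
Proof. by move=> ii0; rewrite tnth_mktuple enum_rankK (negbTE ii0). Qed.

(** The generating pi-system on which independence is given. *)
Definition boxes n : set (set (n.-tuple T)) :=
  [set A | exists2 B : 'I_n -> set T, (forall i, measurable (B i)) &
    A = [set t | forall i, B i (tnth t i)]].

Lemma measurable_boxes n : measurable = <<s @boxes n >>.
Proof.
apply/seteqP; split.
  apply: smallest_sub; first exact: smallest_sigma_algebra.
  move=> A; rewrite -bigcup_seq => -[i _ [B mB <-]].
  apply: sub_sigma_algebra; exists (fun j => if j == i then B else setT).
    by move=> j; case: ifP.
  apply/seteqP; split=> [t [_ Bt] j|t /(_ i)]; last by rewrite eqxx.
  by case: eqP => // ->.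
apply: smallest_sub; first exact: sigma_algebra_measurable.
move=> _ [B mB ->].
rewrite (_ : mkset _ = \bigcap_(i in [set: 'I_n]) ((fun t => tnth t i) @^-1` B i)).
  apply: fin_bigcap_measurable => [|i _]; first exact: finite_finset.
  by rewrite -[X in measurable X]setTI; exact: measurable_tnth.
by apply/seteqP; split=> t Bt i => [_|]; exact: Bt.
Qed.

Hypothesis indD : independent_family P (fun i => D i : Omega -> T).

(** Both sides are finite measures in A that agree on boxes; a box whose side
    of index i0 misses the constant has an empty preimage. *)
Lemma others_indep i0 A B : measurable A -> measurable B ->
  P (others i0 @^-1` A `&` D i0 @^-1` B) =
  (P (others i0 @^-1` A) * P (D i0 @^-1` B))%E.
Proof.
move=> mA mB.
have mDB : measurable (D i0 @^-1` B).
  by rewrite -[X in measurable X]setTI; exact: measurable_funP.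
have PDB : (fine (P (D i0 @^-1` B)))%:E = P (D i0 @^-1` B).
  by rewrite fineK // fin_num_measure.
pose c := NngNum (fine_ge0 (measure_ge0 P (D i0 @^-1` B))).
pose m1 := pushforward (mrestr P mDB) (others i0).
pose m2 := mscale c (distribution P (others i0)).
suff : m1 A = m2 A.
  by rewrite /m1 /m2 /pushforward /mrestr /mscale /= PDB muleC.
apply: (measure_unique (@boxes #|J|) (fun=> setT)) mA.
- exact: measurable_boxes.
- move=> _ _ [B1 mB1 ->] [B2 mB2 ->]; exists (fun i => B1 i `&` B2 i).
    by move=> i; exact: measurableI.
  apply/seteqP; split=> t /=; first by move=> [t1 t2] i; split.
  by move=> t12; split=> i; case: (t12 i).
- by move=> _; exists (fun=> setT) => //; apply/seteqP; split.
- by apply/seteqP; split=> // t _; exists 0%N.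
- move=> _ [C mC ->]; set A' := [set t | _].
  rewrite -[LHS]/(P (others i0 @^-1` A' `&` D i0 @^-1` B)).
  rewrite -[RHS]/((fine (P (D i0 @^-1` B)))%:E * P (others i0 @^-1` A'))%E.
  have [Cp|Cp] := pselect (C (enum_rank i0) point); last first.
    rewrite (_ : others i0 @^-1` A' = set0) ?set0I ?measure0 ?mule0//.
    apply/seteqP; split=> // w /(_ (enum_rank i0)).
    by rewrite tnth_mktuple enum_rankK eqxx.
  have E B0 : others i0 @^-1` A' `&` D i0 @^-1` B0
      = \bigcap_i (D i @^-1` (if i == i0 then B0 else C (enum_rank i))).
    apply/seteqP; split=> [w [/= Cw B0w] i _ /=|w Cw].
      by case: ifPn => [/eqP ->//|ii0]; rewrite -(tnth_others w ii0).
    split=> [i|]; last by have /= := Cw i0 I; rewrite eqxx.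
    rewrite tnth_mktuple; case: ifPn => [/eqP ii0|ii0].
      by rewrite -(enum_valK i) ii0.
    by have /= := Cw (enum_val i) I; rewrite (negbTE ii0) enum_valK.
  have P_E B0 : measurable B0 ->
    P (others i0 @^-1` A' `&` D i0 @^-1` B0) =
    (P (D i0 @^-1` B0) * \prod_(i | i != i0) P (D i @^-1` C (enum_rank i)))%E.
    move=> mB0; rewrite E indD => [|i]; last by case: ifP.
    rewrite (bigD1 i0)//= eqxx; congr (_ * _)%E.
    by apply: eq_bigr => i /negbTE ->.
  rewrite P_E // -[in RHS](setIT (_ @^-1` A')) -(preimage_setT (D i0)) P_E //.
  have P1 : P (D i0 @^-1` setT) = 1%E by rewrite preimage_setT probability_setT.
  by rewrite PDB P1 mul1e.
- move=> _; rewrite -[X in (X < _)%E]/(P (others i0 @^-1` setT `&` D i0 @^-1` B)).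
  by rewrite preimage_setT setTI ltey_eq fin_num_measure.
Qed.

Variable Z : {RV P >-> T}.
Hypothesis lawD : forall i, same_law P (D i) Z.

Lemma integral_others i0 (f : #|J|.-tuple T * T -> \bar R) :
  measurable_fun setT f -> (forall x, 0 <= f x)%E ->
  (\int[P]_w f (others i0 w, D i0 w) =
   \int[P]_w \int[P]_w' f (others i0 w, Z w'))%E.
Proof. by apply: integral_indep => // A B; exact: others_indep. Qed.

Variables (n : nat) (e : 'I_n -> J).

Definition subsample (w : Omega) : n.-tuple T := [tuple D (e i) w | i < n].

Let sub_others (t : #|J|.-tuple T) : n.-tuple T :=
  [tuple tnth t (enum_rank (e i)) | i < n].

Let measurable_sub_others : measurable_fun setT sub_others.
Proof.
apply/measurable_fun_tnthP => i.
rewrite (_ : _ \o _ = (fun t => tnth t (enum_rank (e i)))).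
  exact: measurable_tnth.
by apply/funext => t /=; rewrite tnth_mktuple.
Qed.

Let subsampleE i0 w : (forall i, e i != i0) ->
  subsample w = sub_others (others i0 w).
Proof.
move=> ei0; apply: eq_from_tnth => i.
by rewrite !tnth_mktuple enum_rankK (negbTE (ei0 i)).
Qed.

Let measurable_sub_pair : measurable_fun setT
  (fun x : #|J|.-tuple T * T => (sub_others x.1, x.2)).
Proof.
apply/measurable_fun_pairP; split; last exact: measurable_snd.
by apply: (measurableT_comp measurable_sub_others).
Qed.

Lemma measurable_subsample : measurable_fun setT subsample.
Proof.
apply/measurable_fun_tnthP => i.
rewrite (_ : _ \o _ = D (e i)); first exact: measurable_funP.
by apply/funext => t /=; rewrite tnth_mktuple.
Qed.

(** Conditionally on a subsample, an observation outside it is integrated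
    out with the common law. *)
Lemma integral_subsample i0 (f : n.-tuple T * T -> \bar R) :
  (forall i, e i != i0) ->
  measurable_fun setT f -> (forall x, 0 <= f x)%E ->
  (\int[P]_w f (subsample w, D i0 w) =
   \int[P]_w \int[P]_w' f (subsample w, Z w'))%E.
Proof.
move=> ei0 mf f0.
pose g (x : #|J|.-tuple T * T) := f (sub_others x.1, x.2).
have := @integral_others i0 g; rewrite /g /=.
under eq_integral do rewrite -(subsampleE _ ei0).
under [in X in _ -> _ -> _ = X]eq_integral do
  under eq_integral do rewrite -(subsampleE _ ei0).
apply=> [|x]; last exact: f0.
exact: (measurableT_comp mf measurable_sub_pair).
Qed.

(** Given the subsample, the factors are independent with conditional
    expectation at most 1; they are integrated out one at a time. *)
Lemma integral_prod_subsample_le (F : n.-tuple T -> R) (f : n.-tuple T * T -> R)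
    (ks : seq J) :
  measurable_fun setT F -> (forall v, 0 <= F v) ->
  measurable_fun setT f -> (forall x, 0 <= f x) ->
  (forall v, \int[P]_w (f (v, Z w))%:E <= 1)%E ->
  uniq ks -> (forall k, k \in ks -> forall i, e i != k) ->
  (\int[P]_w (F (subsample w) * \prod_(k <- ks) f (subsample w, D k w))%:E <=
   \int[P]_w (F (subsample w))%:E)%E.
Proof.
move=> mF F0 mf f0 f1; elim: ks => [|k ks IH] /=.
  by move=> _ _; under eq_integral do rewrite big_nil mulr1.
move=> /andP[kks uks] eks.
have {}IH := IH uks (fun j jks => eks j (@mem_behead _ (k :: ks) j jks)).
apply: le_trans IH; have ek := eks k (mem_head _ _).
pose G (v : #|J|.-tuple T) :=
  F (sub_others v) * \prod_(j <- ks) f (sub_others v, tnth v (enum_rank j)).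
have GE w : F (subsample w) * \prod_(j <- ks) f (subsample w, D j w) =
            G (others k w).
  rewrite /G -(subsampleE _ ek); congr (_ * _).
  apply: eq_big_seq => j jks; rewrite tnth_others//.
  by apply: contraNneq kks => <-.
have G0 v : 0 <= G v by rewrite mulr_ge0// prodr_ge0.
have mG : measurable_fun setT G.
  apply: measurable_funM; first exact: measurableT_comp.
  apply: measurable_prod => j _; apply: measurableT_comp => //.
  by apply/measurable_fun_pairP; split=> //=; exact: measurable_tnth.
pose g (x : #|J|.-tuple T * T) := (G x.1 * f (sub_others x.1, x.2))%:E.
have -> : (\int[P]_w (F (subsample w) *
    \prod_(j <- k :: ks) f (subsample w, D j w))%:E =
  \int[P]_w g (others k w, D k w))%E.
  apply: eq_integral => w _; rewrite big_cons mulrCA GE mulrC /g /=.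
  by rewrite -(subsampleE _ ek).
have mfs : measurable_fun setT
    (fun x : #|J|.-tuple T * T => f (sub_others x.1, x.2)).
  exact: (measurableT_comp mf measurable_sub_pair).
have g0 x : (0 <= g x)%E by rewrite lee_fin mulr_ge0.
have mg : measurable_fun setT g.
  apply/measurable_EFinP; apply: measurable_funM => //.
  exact: (measurableT_comp mG measurable_fst).
rewrite integral_others //.
under [leRHS]eq_integral do rewrite GE.
apply: ge0_le_integral => //.
- by move=> w _; apply: integral_ge0 => w' _; rewrite lee_fin mulr_ge0.
- exact: (measurableT_comp (measurable_integral_rv Z mg g0)).
- by apply/measurable_EFinP; exact: measurableT_comp.
move=> w _; rewrite /g /=; under eq_integral do rewrite EFinM.
rewrite ge0_integralZl// ?lee_fin//.
- by rewrite -[leRHS]mule1 lee_wpmul2l // lee_fin; exact: G0.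
- apply/measurable_EFinP; apply: (measurableT_comp mf).
  apply: measurable_fun_pair; first exact: measurable_cst.
  exact: measurable_funPT.
- by move=> w' _; rewrite lee_fin.
Qed.

End Independence.

(** * The margin condition and the exponential moment of the excess contrast *)

Lemma measurable_boolR d (T : measurableType d) (R : realType) (b : T -> bool) :
  measurable_fun setT b -> measurable_fun setT (fun x => (b x)%:R : R).
Proof.
move=> mb; rewrite (_ : (fun x => _) = fun x => if b x then 1 else 0).
  by apply: measurable_fun_ifT => //; exact: measurable_cst.
by apply/funext => x; case: (b x).
Qed.

(** From exp x <= 1 / (1 - x). *)
Lemma expR_le_quad (R : realType) (x : R) :
  x <= 2^-1 -> expR x <= 1 + x + 2 * x ^+ 2.
Proof.
move=> x2; have x1 : 0 < 1 - x by lra.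
have e1 : expR x * (1 - x) <= 1.
  rewrite -ler_pdivlMr// div1r -[X in X <= _]invrK lef_pV2 ?posrE ?invr_gt0 ?expR_gt0//.
  by rewrite -expRN expR_ge1Dx.
have : (1 + x + 2 * x ^+ 2) * (1 - x) >= 1 by nra.
by move=> /(le_trans e1); rewrite ler_pM2r.
Qed.

Section Margin.
Context {R : realType} {p : nat} {d : measure_display} {Omega : measurableType d}.
Variable P : probability Omega R.

Lemma bounded_Rintegrable (f : Omega -> R) (K : R) :
  measurable_fun setT f -> (forall w, `|f w| <= K) ->
  P.-integrable setT (EFin \o f).
Proof.
move=> mf fK; apply: measurable_bounded_integrable => //.
  by rewrite [X in (X < _)%E]probability_setT ltry.
by exists K; split=> [|M KM w _ /=]; rewrite ?num_real// (le_trans (fK w))// ltW.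
Qed.

Lemma RintegrableB (A : set Omega) (f g : Omega -> R) : measurable A ->
  P.-integrable A (EFin \o f) -> P.-integrable A (EFin \o g) ->
  P.-integrable A (EFin \o (fun w => f w - g w)).
Proof. by move=> mA intf intg; have := integrableB mA intf intg. Qed.

Lemma RintegrableD (A : set Omega) (f g : Omega -> R) : measurable A ->
  P.-integrable A (EFin \o f) -> P.-integrable A (EFin \o g) ->
  P.-integrable A (EFin \o (fun w => f w + g w)).
Proof. by move=> mA intf intg; have := integrableD mA intf intg. Qed.

Lemma RintegrableZ (A : set Omega) (f : Omega -> R) (c : R) : measurable A ->
  P.-integrable A (EFin \o f) ->
  P.-integrable A (EFin \o (fun w => c * f w)).
Proof. by move=> mA intf; have := integrableZl mA c intf. Qed.

Lemma Rintegral_sum (A : set Omega) (I : Type) (r : seq I) (Q : pred I)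
    (f : I -> Omega -> R) :
  measurable A -> (forall i, Q i -> P.-integrable A (EFin \o f i)) ->
  P.-integrable A (EFin \o (fun w => \sum_(i <- r | Q i) f i w)) /\
  \int[P]_(w in A) (\sum_(i <- r | Q i) f i w) =
  \sum_(i <- r | Q i) \int[P]_(w in A) f i w.
Proof.
move=> mA intf; elim: r => [|i r [IH1 IH2]].
  rewrite big_nil; under eq_Rintegral do rewrite big_nil.
  rewrite Rintegral_cst// mul0r; split=> //.
  by under eq_fun do rewrite big_nil; exact: finite_measure_integrable_cst.
have [Qi|Qi] := boolP (Q i).
  split; first by under eq_fun do rewrite big_cons Qi;
    apply: RintegrableD => //; exact: intf.
  under eq_Rintegral do rewrite big_cons Qi.
  by rewrite big_cons Qi RintegralD// ?IH2//; exact: intf.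
split; first by under eq_fun do rewrite big_cons (negbTE Qi).
under eq_Rintegral do rewrite big_cons (negbTE Qi).
by rewrite big_cons (negbTE Qi).
Qed.

Lemma Rintegral_prob_cst (c : R) : \int[P]_w c = c.
Proof. by rewrite Rintegral_cst// [X in fine X]probability_setT mulr1. Qed.

Variables (X : {RV P >-> p.-tuple R}) (Y : {RV P >-> bool}).
Variables (eta : p.-tuple R -> R) (h : R).
Hypothesis meta : measurable_fun setT eta.
Hypothesis condY : is_cond_exp P X (fun w => (Y w)%:R) (eta \o X).
Hypothesis h0 : 0 < h.
Hypothesis margin : forall x, h <= `|2 * eta x - 1|.
Implicit Types u : p.-tuple R -> bool.

Definition risk u : R := \int[P]_w contrast u (X w, Y w).

Lemma lossE s u : loss P X Y s u = risk u - risk s.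
Proof. by rewrite /loss unlock. Qed.

Lemma contrastE u (z : obs R p) : contrast u z = (z.2 (+) u z.1)%:R.
Proof.
rewrite /contrast; case: z.2 (u z.1) => -[] /=.
- by rewrite subrr expr0n.
- by rewrite subr0 expr1n.
- by rewrite sub0r sqrrN expr1n.
- by rewrite subrr expr0n.
Qed.

Lemma contrast01 u z : 0 <= contrast u z <= 1.
Proof. by rewrite contrastE; case: (_ (+) _); rewrite ?lexx ?ler01. Qed.

Lemma measurable_contrast d' (T : measurableType d')
    (u : T -> p.-tuple R -> bool) :
  measurable_fun setT (fun x : T * p.-tuple R => u x.1 x.2) ->
  measurable_fun setT (fun x : T * obs R p => contrast (u x.1) x.2).
Proof.
move=> mu; rewrite (_ : (fun x => _) = fun x => (x.2.2 (+) u x.1 x.2.1)%:R).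
  apply: measurable_boolR.
  rewrite (_ : (fun x => _) =
    fun x => if x.2.2 then ~~ u x.1 x.2.1 else u x.1 x.2.1).
    have mux : measurable_fun setT (fun x : T * obs R p => u x.1 x.2.1).
      have mg : measurable_fun setT (fun x : T * obs R p => (x.1, x.2.1)).
        apply: measurable_fun_pair; first exact: measurable_fst.
        by apply: (measurableT_comp measurable_fst); exact: measurable_snd.
      exact: (measurableT_comp mu mg).
    apply: measurable_fun_ifT => //; last exact: measurable_neg.
    by apply: (measurableT_comp measurable_snd); exact: measurable_snd.
  by apply/funext => x; case: x.2.2.
by apply/funext => x; rewrite contrastE.
Qed.

Let mX : measurable_fun setT X := measurable_funPT X.
Let mY : measurable_fun setT Y := measurable_funPT Y.

Let mc u : measurable_fun setT u ->
  measurable_fun setT (fun w => contrast u (X w, Y w)).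
Proof.
move=> mu; rewrite (_ : (fun w => _) = fun w => (Y w (+) u (X w))%:R).
  apply: measurable_boolR.
  rewrite (_ : (fun w => _) = fun w => if Y w then ~~ u (X w) else u (X w)).
    have muX := measurableT_comp mu mX.
    by apply: measurable_fun_ifT => //; exact: measurable_neg.
  by apply/funext => w; case: (Y w).
by apply/funext => w; rewrite contrastE.
Qed.

Let ic u : measurable_fun setT u ->
  P.-integrable setT (EFin \o (fun w => contrast u (X w, Y w))).
Proof.
move=> mu; apply: (@bounded_Rintegrable _ 1); first exact: mc.
by move=> w; have /andP[c0 c1] := contrast01 u (X w, Y w); rewrite ger0_norm.
Qed.

Let ib (b : Omega -> bool) : measurable_fun setT b ->
  P.-integrable setT (EFin \o (fun w => (b w)%:R)).
Proof.
move=> mb; apply: (@bounded_Rintegrable _ 1); first exact: measurable_boolR.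
by move=> w; case: (b w); rewrite ?normr1 ?normr0.
Qed.

Lemma risk_ge0 u : 0 <= risk u.
Proof. by apply: Rintegral_ge0 => w _; case/andP: (contrast01 u (X w, Y w)). Qed.

Lemma risk_le1 u : measurable_fun setT u -> risk u <= 1.
Proof.
move=> mu; rewrite /risk.
apply: (@le_trans _ _ (\int[P]_w 1)).
  apply: le_Rintegral => //; first exact: ic.
    by apply: (@bounded_Rintegrable _ 1) => // w; rewrite normr1.
  by move=> w _; case/andP: (contrast01 u (X w, Y w)).
by rewrite Rintegral_prob_cst.
Qed.

Lemma measurable_bayes : measurable_fun setT (bayes eta).
Proof. by apply: measurable_fun_ler => //; exact: measurable_cst. Qed.

Let Rintegral_boolE (b : p.-tuple R -> bool) (f : Omega -> R) :
  \int[P]_(w in [set w | b (X w)]) f w = \int[P]_w ((b (X w))%:R * f w).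
Proof.
rewrite Rintegral_mkcond; apply: eq_Rintegral => w _.
rewrite patchE; case: ifPn => [|/negP].
  by rewrite inE /= => ->; rewrite mul1r.
by rewrite inE /=; case: (b (X w)) => [/(_ isT)//|_]; rewrite mul0r.
Qed.

Let integrable_bool (b : p.-tuple R -> bool) (f : Omega -> R) :
  measurable_fun setT b -> P.-integrable setT (EFin \o f) ->
  P.-integrable setT (EFin \o (fun w => (b (X w))%:R * f w)).
Proof.
move=> mb intf; apply/integrableP.
have /integrableP[mf foo] := intf; split.
  apply/measurable_EFinP; apply: measurable_funM; last exact/measurable_EFinP.
  by apply: measurable_boolR; exact: measurableT_comp.
apply: le_lt_trans foo; apply: ge0_le_integral => //.
- apply: measurableT_comp => //; apply/measurable_EFinP; apply: measurable_funM.
    by apply: measurable_boolR; exact: measurableT_comp.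
  exact/measurable_EFinP.
- exact: measurableT_comp.
move=> w _ /=; rewrite lee_fin; case: (b (X w)); first by rewrite mul1r.
by rewrite mul0r normr0.
Qed.

Let ieta (b : p.-tuple R -> bool) : measurable_fun setT b ->
  P.-integrable setT (EFin \o (fun w => (b (X w))%:R * eta (X w))).
Proof. by have [_ ie _ _] := condY => mb; exact: integrable_bool. Qed.

Let iY (b : p.-tuple R -> bool) : measurable_fun setT b ->
  P.-integrable setT (EFin \o (fun w => (b (X w))%:R * (Y w)%:R)).
Proof. by have [ie _ _ _] := condY => mb; exact: integrable_bool. Qed.

(** The defining property of the regression function on the event b(X). *)
Lemma regression_transfer (b : p.-tuple R -> bool) : measurable_fun setT b ->
  \int[P]_w ((b (X w))%:R * (Y w)%:R) = \int[P]_w ((b (X w))%:R * eta (X w)).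
Proof.
move=> mb; have [_ _ _ cE] := condY.
rewrite -!Rintegral_boolE /Rintegral -cE//.
exists [set x | b x]; last by rewrite setTI.
by have := mb measurableT [set true] I; rewrite setTI.
Qed.

Let s := bayes eta.

Let idiff u : measurable_fun setT u ->
  P.-integrable setT (EFin \o (fun w => (u (X w) (+) s (X w))%:R)).
Proof.
move=> mu; apply: ib; rewrite (_ : (fun w => _) =
    fun w => if u (X w) then ~~ s (X w) else s (X w)).
  have muX := measurableT_comp mu mX.
  have msX := measurableT_comp measurable_bayes mX.
  by apply: measurable_fun_ifT => //; exact: measurable_neg.
by apply/funext => w; case: (u _).
Qed.

(** The excess contrast equals (u - s) (1 - 2 Y); replacing Y by eta(X) gives
    |2 eta(X) - 1| on the event u(X) <> s(X), by the definition of s. *)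
Lemma margin_le_loss u : measurable_fun setT u ->
  h * \int[P]_w (u (X w) (+) s (X w))%:R <= risk u - risk s.
Proof.
move=> mu; have ms : measurable_fun setT s := measurable_bayes.
(* u - s is the difference of the indicators b1 and b2 *)
pose b1 x := u x && ~~ s x; pose b2 x := ~~ u x && s x.
have mb1 : measurable_fun setT b1.
  by apply: measurable_and => //; exact: measurable_neg.
have mb2 : measurable_fun setT b2.
  by apply: measurable_and => //; exact: measurable_neg.
pose D w : R := (b1 (X w))%:R - (b2 (X w))%:R.
have iD : P.-integrable setT (EFin \o D).
  by apply: RintegrableB => //; apply: ib; exact: measurableT_comp.
have iE (f : Omega -> R) :
  P.-integrable setT (EFin \o (fun w => (b1 (X w))%:R * f w)) ->
  P.-integrable setT (EFin \o (fun w => (b2 (X w))%:R * f w)) ->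
  P.-integrable setT (EFin \o (fun w =>
    2 * ((b1 (X w))%:R * f w - (b2 (X w))%:R * f w))).
  by move=> i1 i2; apply: RintegrableZ => //; apply: RintegrableB.
have EY := iE _ (iY mb1) (iY mb2); have Eeta := iE _ (ieta mb1) (ieta mb2).
have -> : risk u - risk s =
    \int[P]_w (D w - 2 * ((b1 (X w))%:R * eta (X w) - (b2 (X w))%:R * eta (X w))).
  rewrite RintegralB// RintegralZl//; last first.
    by apply: RintegrableB => //; exact: ieta.
  rewrite [X in 2 * X]RintegralB//; [|exact: ieta|exact: ieta].
  rewrite -!regression_transfer// -[X in 2 * X]RintegralB//; [|exact: iY|exact: iY].
  rewrite -RintegralZl//; last by apply: RintegrableB => //; exact: iY.
  rewrite -RintegralB// /risk -RintegralB//; [|exact: ic|exact: ic].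
  apply: eq_Rintegral => w _; rewrite !contrastE /D /b1 /b2 /=.
  by case: (Y w) (u (X w)) (s (X w)) => -[] [] /=; lra.
rewrite -RintegralZl//; last exact: idiff.
apply: le_Rintegral => //.
- by apply: RintegrableZ => //; exact: idiff.
- by apply: RintegrableB.
move=> w _; have := margin (X w); rewrite /D /b1 /b2 /s /bayes.
case: (leP 2^-1 (eta (X w))) => et; [rewrite ger0_norm|rewrite ltr0_norm]; try lra.
  by case: (u (X w)) => /=; lra.
by case: (u (X w)) => /=; lra.
Qed.

(** The bound of margin_le_loss for the complement of s, whose loss is at
    most 1. *)
Lemma margin_le1 : h <= 1.
Proof.
have mn : measurable_fun setT (fun x => ~~ s x).
  by apply: measurable_neg; exact: measurable_bayes.
have := margin_le_loss mn.
under eq_Rintegral do rewrite addNb addbb /=.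
rewrite Rintegral_prob_cst mulr1.
have := risk_le1 mn; have := risk_ge0 s; lra.
Qed.

(** With t = h/4, the mean of exp (- t dc) is at most
    1 - t l + 2 t^2 P(u <> s) <= 1 - (h/4) l + (h/8) l <= exp (- h/8 l), where dc
    is the excess contrast, dc^2 is the indicator of u <> s and l is the loss. *)
Lemma expR_margin_le u : measurable_fun setT u ->
  (\int[P]_w (expR (h / 8 * (risk u - risk s)
     - h / 4 * (contrast u (X w, Y w) - contrast s (X w, Y w))))%:E <= 1)%E.
Proof.
move=> mu; have ms : measurable_fun setT s := measurable_bayes.
have h1 := margin_le1.
pose q w : R := (u (X w) (+) s (X w))%:R.
have iq : P.-integrable setT (EFin \o q).
  exact: idiff.
pose dc w := contrast u (X w, Y w) - contrast s (X w, Y w).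
have idc : P.-integrable setT (EFin \o dc).
  by apply: RintegrableB => //; exact: ic.
have mdc : measurable_fun setT dc by apply: measurable_funB; exact: mc.
have dc1 w : `|dc w| <= 1.
  rewrite ler_norml /dc; have /andP[] := contrast01 u (X w, Y w).
  by have /andP[] := contrast01 s (X w, Y w); lra.
set l := risk u - risk s; set t := h / 4.
have t0 : 0 < t by rewrite divr_gt0.
have tdc w : - (t * dc w) <= t.
  rewrite -mulrN -[leRHS]mulr1 ler_pM2l//.
  by have := dc1 w; rewrite ler_norml => /andP[]; lra.
have lE : \int[P]_w dc w = l by rewrite RintegralB//; exact: ic.
have me : measurable_fun setT (fun w => expR (h / 8 * l - t * dc w)).
  apply: measurableT_comp; first exact: measurable_expR.
  by apply: measurable_funB => //; apply: measurable_funM.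
have ie : P.-integrable setT (EFin \o (fun w => expR (h / 8 * l - t * dc w))).
  apply: (@bounded_Rintegrable _ (expR (h / 8 * l + t))) => // w.
  rewrite ger0_norm ?expR_ge0// ler_expR lerD2l; exact: tdc.
have ei : P.-integrable setT
    (EFin \o (fun w => expR (h / 8 * l) * (1 + (2 * t ^+ 2 * q w - t * dc w)))).
  apply: RintegrableZ => //; apply: RintegrableD => //.
    by apply: (@bounded_Rintegrable _ 1) => // w; rewrite normr1.
  by apply: RintegrableB => //; apply: RintegrableZ.
suff : \int[P]_w expR (h / 8 * l - t * dc w) <= 1.
  by rewrite -lee_fin fineK//; exact: integrable_fin_num.
apply: (@le_trans _ _
  (\int[P]_w (expR (h / 8 * l) * (1 + (2 * t ^+ 2 * q w - t * dc w))))).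
  apply: le_Rintegral => // w _; rewrite expRD ler_pM2l ?expR_gt0//.
  have dcq : dc w ^+ 2 = q w.
    rewrite /dc /q !contrastE /=.
    by case: (Y w) (u (X w)) (s (X w)) => -[] [] /=; lra.
  apply: le_trans (expR_le_quad _) _; first by have := tdc w;
    rewrite /t; lra.
  by rewrite sqrrN exprMn dcq; lra.
rewrite RintegralZl//; last by apply: RintegrableD => //;
  [apply: (@bounded_Rintegrable _ 1) => // w; rewrite normr1|
   apply: RintegrableB => //; apply: RintegrableZ].
rewrite RintegralD//; last 2 first.
- by apply: (@bounded_Rintegrable _ 1) => // w; rewrite normr1.
- by apply: RintegrableB => //; apply: RintegrableZ.
rewrite Rintegral_prob_cst RintegralB//; [|exact: RintegrableZ|exact: RintegrableZ].
rewrite !RintegralZl// lE -ler_pdivlMl ?expR_gt0// mulr1 -expRN.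
apply: le_trans (expR_ge1Dx _).
have : h / 8 * (h * \int[P]_w q w) <= h / 8 * l.
  by rewrite ler_pM2l ?divr_gt0//; exact: margin_le_loss.
by rewrite /t; lra.
Qed.

End Margin.

(** * From integrals over preimages to almost sure inequalities *)

Section AlmostSureComparison.
Context {d : measure_display} {Omega : measurableType d} {R : realType}.
Context {d' : measure_display} {T : measurableType d'}.
Variable P : probability Omega R.

(** The event where the inequality fails belongs to the sigma-algebra of V, so
    the hypothesis applies to it and forces it to be negligible. *)
Lemma ae_le_comp (V : Omega -> T) (W : Omega -> R) (G : T -> R) :
  measurable_fun setT V -> measurable_fun setT G ->
  P.-integrable setT (EFin \o W) -> P.-integrable setT (EFin \o (G \o V)) ->
  (forall B, measurable B -> g_sigma_algebra_preimage V (W @^-1` B)) ->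
  (forall B, measurable B ->
    \int[P]_(w in V @^-1` B) W w <= \int[P]_(w in V @^-1` B) G (V w)) ->
  {ae P, forall w, W w <= G (V w)}.
Proof.
move=> mV mG iW iG mW WG.
(* S is Omega with the sigma-algebra generated by V *)
pose S := g_sigma_algebra_preimageType V.
have mWS : measurable_fun [set: S] (W : S -> R).
  by move=> _ B mB; rewrite setTI; exact: mW.
have mGS : measurable_fun [set: S] (G \o V : S -> R).
  move=> _ B mB; rewrite setTI; exists (G @^-1` B); last by rewrite setTI.
  by rewrite -[X in measurable X]setTI; exact: mG.
have [B mB AE] : g_sigma_algebra_preimage V [set w | G (V w) < W w].
  have := @measurable_fun_ltr _ S R setT _ _ mGS mWS measurableT [set true] I.
  by rewrite setTI; congr (g_sigma_algebra_preimage V _).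
rewrite setTI in AE; set A := V @^-1` B in AE.
have mA : measurable A by rewrite -[A]setTI; exact: mV.
have iD : P.-integrable A (EFin \o (fun w => W w - G (V w))).
  by apply: RintegrableB => //; [apply: integrableS iW|apply: integrableS iG].
have D0 : (\int[P]_(w in A) `|(W w - G (V w))%:E| = 0)%E.
  have -> : (\int[P]_(w in A) `|(W w - G (V w))%:E| =
             \int[P]_(w in A) (W w - G (V w))%:E)%E.
    apply: eq_integral => w; rewrite inE AE /= => Aw.
    by rewrite ger0_norm// subr_ge0 ltW.
  rewrite -[LHS]fineK; last by exact: integrable_fin_num.
  congr EFin; apply/eqP; rewrite eq_le; apply/andP; split.
    rewrite -[leLHS]/(\int[P]_(w in A) (W w - G (V w))) RintegralB//.
    - by rewrite subr_le0; exact: WG.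
    - exact: integrableS iW.
    - exact: integrableS iG.
  apply: fine_ge0; apply: integral_ge0 => w; rewrite AE /= lee_fin => Aw.
  by rewrite subr_ge0 ltW.
have /integrableP[mD _] := iD.
have [N [mN PN DN]] := (ae_eq_integral_abs P mA mD).1 D0.
exists N; split=> // w /= nWG; apply: DN => /= DE.
have Aw : A w by rewrite AE /= ltNge; apply/negP.
have [/eqP] := DE Aw; rewrite subr_eq0 => /eqP E.
by apply: nWG; rewrite E.
Qed.

Lemma integral_preimage (V : Omega -> T) (B : set T) (f : Omega -> R) :
  (\int[P]_(w in V @^-1` B) (f w)%:E = \int[P]_w (\1_B (V w) * f w)%:E)%E.
Proof.
rewrite integral_mkcond; apply: eq_integral => w _.
rewrite patchE indicE; case: ifPn => [|/negP].
  by rewrite inE /= => Bw; rewrite mem_set// mul1r.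
by rewrite inE /= => Bw; rewrite memNset// mul0r.
Qed.

End AlmostSureComparison.

(** * The oracle inequality *)

Section Oracle.
Context {R : realType} {p n1 n2 n3 : nat}.
Context {d : measure_display} {Omega : measurableType d}.
Variable P : probability Omega R.
Variables (X : {RV P >-> p.-tuple R}) (Y : {RV P >-> bool}).
Variables (eta : p.-tuple R -> R) (h : R).
Variable D : 'I_n1 + 'I_n2 + 'I_n3 -> {RV P >-> obs R p}.
Variable Tmax : {set 'I_p} -> n1.-tuple (obs R p) -> ctree R p.
Hypothesis n2_gt0 : (0 < n2)%N.
Hypothesis meta : measurable_fun setT eta.
Hypothesis condY : is_cond_exp P X (fun w => (Y w)%:R) (eta \o X).
Hypothesis h0 : 0 < h.
Hypothesis margin : forall x, h <= `|2 * eta x - 1|.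
Hypothesis indD : independent_family P (fun i => D i : Omega -> obs R p).
Hypothesis lawD : forall i, same_law P (D i) (fun w => (X w, Y w)).
Hypothesis mTmax : forall M : {set 'I_p}, (0 < #|M|)%N -> measurable_tree (Tmax M).

Let s := bayes eta.
Let ms : measurable_fun setT s := measurable_bayes meta.
Let L1 (w : Omega) := [tuple D (inl (inl i)) w | i < n1].
Let L2 (w : Omega) := [tuple D (inl (inr i)) w | i < n2].
Let train (i : 'I_n1) : 'I_n1 + 'I_n2 + 'I_n3 := inl (inl i).

Definition XY_fun (w : Omega) : obs R p := (X w, Y w).

Lemma measurable_XY : measurable_fun setT XY_fun.
Proof. by apply: measurable_fun_pair; exact: measurable_funPT. Qed.

HB.instance Definition _ := isMeasurableFun.Build _ _ _ _ XY_fun measurable_XY.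

Let XY : {RV P >-> obs R p} := XY_fun.

Let mL1 : measurable_fun setT L1.
Proof. exact: (@measurable_subsample _ _ _ P _ _ _ D _ train). Qed.

Section RandomClassifier.
Variable v : n1.-tuple (obs R p) -> p.-tuple R -> bool.
Hypothesis mv : measurable_fun setT
  (fun x : n1.-tuple (obs R p) * p.-tuple R => v x.1 x.2).

Let mc : measurable_fun setT
  (fun x : n1.-tuple (obs R p) * obs R p => contrast (v x.1) x.2).
Proof. exact: measurable_contrast. Qed.

Let mv1 l : measurable_fun setT (v l).
Proof. exact: (measurableT_comp mv (measurable_pair1 l)). Qed.

Lemma measurable_risk : measurable_fun setT (fun l => risk X Y (v l)).
Proof.
apply: (measurableT_comp (fine_measurable measurableT)).
apply: (@measurable_integral_rv _ _ _ P _ _ _ _ XY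
  (fun x => (contrast (v x.1) x.2)%:E)); first exact/measurable_EFinP.
by move=> x; rewrite lee_fin; case/andP: (contrast01 (v x.1) x.2).
Qed.

Let mcD i : measurable_fun setT (fun w => contrast (v (L1 w)) (D i w)).
Proof.
exact: (measurableT_comp mc (measurable_fun_pair mL1 (measurable_funPT (D i)))).
Qed.

Let icD A i : measurable A ->
  P.-integrable A (EFin \o (fun w => contrast (v (L1 w)) (D i w))).
Proof.
move=> mA; apply: (@integrableS _ _ _ P setT) => //.
apply: (@bounded_Rintegrable _ _ _ _ _ 1) => // w.
by have /andP[c0 c1] := contrast01 (v (L1 w)) (D i w); rewrite ger0_norm.
Qed.

Lemma integrable_risk A : measurable A ->
  P.-integrable A (EFin \o (fun w => risk X Y (v (L1 w)))).
Proof.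
move=> mA; apply: (@integrableS _ _ _ P setT) => //.
apply: (@bounded_Rintegrable _ _ _ _ _ 1) => [|w].
  exact: (measurableT_comp measurable_risk mL1).
by rewrite ger0_norm ?risk_ge0// risk_le1.
Qed.

Lemma integral_contrast B (i : 'I_n2) : measurable B ->
  \int[P]_(w in L1 @^-1` B) contrast (v (L1 w)) (D (inl (inr i)) w) =
  \int[P]_(w in L1 @^-1` B) risk X Y (v (L1 w)).
Proof.
move=> mB; congr fine; rewrite !integral_preimage.
pose f (x : n1.-tuple (obs R p) * obs R p) := (\1_B x.1 * contrast (v x.1) x.2)%:E.
have f0 x : (0 <= f x)%E.
  by rewrite lee_fin mulr_ge0//; case/andP: (contrast01 (v x.1) x.2).
have mf : measurable_fun setT f.
  apply/measurable_EFinP; apply: measurable_funM => //.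
  exact: (measurableT_comp (measurable_indic mB) measurable_fst).
have := @integral_subsample _ _ _ P _ _ _ D indD XY lawD _ train
  (inl (inr i)) f (fun=> isT) mf f0.
rewrite /f /= => ->; apply: eq_integral => w _.
have iX : P.-integrable setT (EFin \o (fun w' => contrast (v (L1 w)) (XY w'))).
  apply: (@bounded_Rintegrable _ _ _ _ _ 1) => [|w'].
    exact: (measurableT_comp (measurableT_comp mc (measurable_pair1 (L1 w)))
      (measurable_funPT XY)).
  by have /andP[c0 c1] := contrast01 (v (L1 w)) (XY w'); rewrite ger0_norm.
under eq_integral do rewrite EFinM.
rewrite integralZl// EFinM fineK//; exact: integrable_fin_num.
Qed.

Lemma integral_empirical B : measurable B ->
  P.-integrable (L1 @^-1` B)
    (EFin \o (fun w => empirical_contrast (L2 w) (v (L1 w)))) /\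
  \int[P]_(w in L1 @^-1` B) empirical_contrast (L2 w) (v (L1 w)) =
  \int[P]_(w in L1 @^-1` B) risk X Y (v (L1 w)).
Proof.
move=> mB; have mA : measurable (L1 @^-1` B).
  by rewrite -[X in measurable X]setTI; exact: mL1.
have [iS ES] := Rintegral_sum (index_enum 'I_n2) (Q := predT) mA
  (fun i _ => icD (inl (inr i)) mA).
have EE w : empirical_contrast (L2 w) (v (L1 w)) =
    n2%:R^-1 * \sum_(i < n2) contrast (v (L1 w)) (D (inl (inr i)) w).
  by congr (_ * _); apply: eq_bigr => i _; rewrite tnth_mktuple.
split; first by under eq_fun do rewrite EE; exact: RintegrableZ.
under eq_Rintegral do rewrite EE.
rewrite RintegralZl// ES; under eq_bigr do rewrite integral_contrast//.
rewrite sumr_const card_ord -[X in _ * X]mulr_natl mulrA mulVf ?mul1r//.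
by rewrite pnatr_eq0 -lt0n.
Qed.

(** By expR_margin_le its conditional mean given the first subsample is at most
    1; the union bound adds up these variables. *)
Definition deviation (w : Omega) : R :=
  \prod_(i < n2) expR (h / 8 * (risk X Y (v (L1 w)) - risk X Y s)
    - h / 4 * (contrast (v (L1 w)) (D (inl (inr i)) w)
               - contrast s (D (inl (inr i)) w))).

Lemma integral_deviation B : measurable B ->
  P.-integrable (L1 @^-1` B) (EFin \o deviation) /\
  \int[P]_(w in L1 @^-1` B) deviation w <= fine (P (L1 @^-1` B)).
Proof.
move=> mB; have mA : measurable (L1 @^-1` B).
  by rewrite -[X in measurable X]setTI; exact: mL1.
pose f (x : n1.-tuple (obs R p) * obs R p) : R :=
  expR (h / 8 * (risk X Y (v x.1) - risk X Y s)
        - h / 4 * (contrast (v x.1) x.2 - contrast s x.2)).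
have mf : measurable_fun setT f.
  apply: measurableT_comp; first exact: measurable_expR.
  apply: measurable_funB.
    apply: measurable_funM => //; apply: measurable_funB => //.
    exact: (measurableT_comp measurable_risk measurable_fst).
  apply: measurable_funM => //; apply: measurable_funB => //.
  apply: (@measurable_contrast _ _ _ _ (fun=> s)).
  exact: (measurableT_comp ms measurable_snd).
pose ks : seq ('I_n1 + 'I_n2 + 'I_n3)%type :=
  [seq inl (inr i) | i <- index_enum 'I_n2].
have dE w : deviation w = \prod_(k <- ks) f (L1 w, D k w) by rewrite big_map.
have Le : (\int[P]_(w in L1 @^-1` B) (deviation w)%:E <= P (L1 @^-1` B))%E.
  rewrite integral_preimage.
  under eq_integral do rewrite dE.
  have uks : uniq ks.
    by rewrite map_inj_uniq ?index_enum_uniq// => i j [].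
  have tks k : k \in ks -> forall j, train j != k by move=> /mapP[i _ ->].
  have B0 l : 0 <= \1_B l :> R by [].
  apply: (le_trans (@integral_prod_subsample_le _ _ _ P _ _ _ D indD XY lawD _
    train (\1_B) f ks (measurable_indic mB) B0 mf (fun=> expR_ge0 _)
    (fun l => expR_margin_le meta condY h0 margin (mv1 l)) uks tks)).
  have -> : (\int[P]_w (\1_B (subsample D train w))%:E =
             \int[P]_w (\1_(L1 @^-1` B) w)%:E)%E by [].
  by rewrite integral_indic// setIT.
have fP : P (L1 @^-1` B) \is a fin_num by exact: fin_num_measure.
have d0 w : 0 <= deviation w by apply: prodr_ge0 => i _; exact: expR_ge0.
have iD : P.-integrable (L1 @^-1` B) (EFin \o deviation).
  apply/integrableP; split.
    apply/measurable_EFinP; apply: (measurable_funS measurableT) => //.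
    rewrite (_ : deviation = fun w => \prod_(k <- ks) f (L1 w, D k w)).
      apply: measurable_prod => k _.
      exact: (measurableT_comp mf (measurable_fun_pair mL1 (measurable_funPT (D k)))).
    by apply/funext => w; exact: dE.
  under eq_integral do rewrite /= ger0_norm//.
  by rewrite (le_lt_trans Le)// ltey_eq fP.
split=> //; rewrite -lee_fin [leRHS]fineK// /Rintegral fineK//; exact: integrable_fin_num.
Qed.

End RandomClassifier.

Section Penalty.
Variables alpha beta : R.
Hypotheses (alpha12 : 12 <= alpha) (beta8 : 8 <= beta).

(** The penalty, with the number of leaves read on the index. *)
Definition lpen (M : {set 'I_p}) (a : ltree) : R :=
  alpha * ((lleaves a)%:R / (n2%:R * h))
  + beta * (#|M|%:R / (n2%:R * h)) * (1 + ln (p%:R / #|M|%:R)).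

(** The share of the index in the union bound. *)
Definition weight M a : R := expR (- (n2%:R * h / 4 * lpen M a)).

Let n2R : 0 < n2%:R :> R. Proof. by rewrite ltr0n. Qed.

(** The constants 12 and 8 are chosen for this: exp (- alpha/4) <= 1/8, so that
    labelled trees contribute at most 1/2, and beta/4 >= 2, so that sets of
    variables contribute at most 1. *)
Lemma sum_weight_le N :
  \sum_(M : {set 'I_p} | (0 < #|M|)%N) \sum_(a <- ltrees N) weight M a <= 1.
Proof.
have a12 := alpha12; have b8 := beta8.
pose y := expR (- (alpha / 4)).
have y8 : y <= 8^-1.
  rewrite /y expRN lef_pV2 ?posrE ?expR_gt0//.
  apply: (@le_trans _ _ (expR 1 ^+ 3)).
    rewrite [leLHS](_ : _ = 2 ^+ 3); last by rewrite -natrX.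
    by rewrite lerXn2r ?nnegrE ?expR_ge0// (le_trans _ (expR_ge1Dx 1)).
  by rewrite -expRM_natl ler_expR; lra.
pose g (M : {set 'I_p}) :=
  expR (- (beta / 4 * (#|M|%:R * (1 + ln (p%:R / #|M|%:R))))).
have wE M a : weight M a = g M * y ^+ lleaves a.
  rewrite /weight /g /y -expRM_natl -expRD; congr expR.
  by rewrite /lpen; field; rewrite ?gt_eqF.
under eq_bigr do under eq_bigr do rewrite wE.
under eq_bigr do rewrite -mulr_sumr.
rewrite -mulr_suml -[leRHS]mulr1; apply: ler_pM => //.
- by apply: sumr_ge0 => M _; exact: expR_ge0.
- by apply: sumr_ge0 => a _; rewrite exprn_ge0// expR_ge0.
- by apply: sum_subsets_le; lra.
- by apply: le_trans (sum_ltrees_le _ _ y8) _; rewrite ?expR_ge0//; lra.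
Qed.

Let vcl (M : {set 'I_p}) (a : ltree) (l : n1.-tuple (obs R p)) :=
  lclass a (Tmax M l).

(** The exponent is n h/8 times the variable whose maximum has to be bounded. *)
Lemma deviation_weightE (v : n1.-tuple (obs R p) -> p.-tuple R -> bool) M a w :
  weight M a * deviation v w =
  expR (n2%:R * h / 8 * (risk X Y (v (L1 w)) - risk X Y s
    - 2 * (empirical_contrast (L2 w) (v (L1 w)) - empirical_contrast (L2 w) s)
    - 2 * lpen M a)).
Proof.
rewrite /weight /deviation -expR_sum -expRD; congr expR.
rewrite sumrB sumr_const card_ord -mulr_sumr sumrB.
have EE u : empirical_contrast (L2 w) u =
    n2%:R^-1 * \sum_(i < n2) contrast u (D (inl (inr i)) w).
  by congr (_ * _); apply: eq_bigr => i _; rewrite tnth_mktuple.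
by rewrite !EE -[X in _ + (X - _)]mulr_natl; field; rewrite gt_eqF.
Qed.

Variable phi : R -> R.
Variable shat : {set 'I_p} * ctree R p -> n2.-tuple (obs R p) ->
  p.-tuple R -> bool.
Variable MThat : n1.-tuple (obs R p) -> n2.-tuple (obs R p) ->
  {set 'I_p} * ctree R p.
Let Models l1 := models (Tmax ^~ l1).
Let stilde w := shat (MThat (L1 w) (L2 w)) (L2 w).
Hypothesis maxT : forall (M : {set 'I_p}) (l1 : n1.-tuple (obs R p)),
  (0 < #|M|)%N -> maximal_tree phi M l1 (Tmax M l1).
Hypothesis shatP : forall l1 l2 MT, Models l1 MT ->
  is_argmin (classifiers MT.2) (empirical_contrast l2) (shat MT l2).
Hypothesis MThatP : forall l1 l2, is_argmin (Models l1)
  (fun MT => empirical_contrast l2 (shat MT l2) + pen alpha beta h n2 MT)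
  (MThat l1 l2).

Lemma models_lclass l1 MT u : Models l1 MT -> classifiers MT.2 u ->
  exists2 a, a \in ltrees n1 &
    u = vcl MT.1 a l1 /\ pen alpha beta h n2 MT = lpen MT.1 a.
Proof.
move=> [M0 pT] uT; have dT := depth_maximal_tree (maxT l1 M0).
rewrite size_tuple in dT.
have [a an1 [la ->]] := classifiers_lclass pT dT uT.
by exists a => //; split=> //; rewrite /pen /lpen la.
Qed.

(** Deterministic inequality.  The loss of the selected classifier, of index
    (M', a'), is 2 (empirical excess contrast + penalty) plus an excess x; the
    first part is at most its analogue for the competitor (M, a) by the choice of
    the model, and x <= exp (c x) / c with c = n h/8, one term of the sum.  The
    contrasts of s and of the competitor stay on opposite sides, so that
    integral_empirical applies to each of them. *)
Lemma selection_bound w (M : {set 'I_p}) a : (0 < #|M|)%N ->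
  loss P X Y s (stilde w) + 2 * empirical_contrast (L2 w) s <=
  2 * empirical_contrast (L2 w) (vcl M a (L1 w)) + (2 * lpen M a +
  8 / (n2%:R * h) * \sum_(M' : {set 'I_p} | (0 < #|M'|)%N)
    \sum_(a' <- ltrees n1) weight M' a' * deviation (vcl M' a') w).
Proof.
have a12 := alpha12.
move=> M0; rewrite lossE.
have [inM minM] := MThatP (L1 w) (L2 w).
have [cl _] := shatP (L2 w) inM.
have [a' a'n1 [uE penE]] := models_lclass inM cl.
(* a model that contains the competitor, with no larger penalty *)
have [T' [pT' nT' cT']] := lclass_classifiers a (Tmax M (L1 w)).
have inT' : Models (L1 w) (M, T') by [].
have [_ /(_ _ cT') /= minT'] := shatP (L2 w) inT'.
have {minM} := minM _ inT'; rewrite -/(stilde w) in uE *.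
have penT' : pen alpha beta h n2 (M, T') <= lpen M a.
  rewrite /pen /lpen /= lerD2r ler_wpM2l//; first by lra.
  by rewrite ler_pM2r ?invr_gt0 ?mulr_gt0// ler_nat.
rewrite penE uE; set M' := (MThat _ _).1 in uE penE *.
have M'0 : (0 < #|M'|)%N by case: inM.
set S := \sum_(_ | _) _.
have leS : weight M' a' * deviation (vcl M' a') w <= S.
  have d0 N b : 0 <= weight N b * deviation (vcl N b) w.
    by rewrite deviation_weightE expR_ge0.
  rewrite /S (bigD1 M')//= (big_rem a')//= -addrA lerDl addr_ge0//.
    by apply: sumr_ge0 => b _.
  by apply: sumr_ge0 => N _; apply: sumr_ge0 => b _.
rewrite deviation_weightE in leS.
set r' := risk X Y _; set g' := empirical_contrast _ (vcl M' a' _).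
rewrite -/r' -/g' in leS.
set x := r' - _ - _ - _ in leS; set c := n2%:R * h / 8 in leS.
have c0 : 0 < c by rewrite divr_gt0// mulr_gt0.
have cx : x <= 8 / (n2%:R * h) * S.
  have -> : 8 / (n2%:R * h) = c^-1.
    by rewrite /c invf_div.
  rewrite ler_pdivlMl//; apply: le_trans leS.
  by have := expR_ge1Dx (c * x); lra.
rewrite /x in cx; move: minT' cx penT'.
rewrite -/(vcl M a (L1 w)).
set ST := 8 / _ * S; lra.
Qed.

Variable W : Omega -> R.
Hypothesis condW : is_cond_exp P L1 (fun w => loss P X Y s (stilde w)) W.

Let mvcl (M : {set 'I_p}) a : (0 < #|M|)%N ->
  measurable_fun setT (fun x : n1.-tuple (obs R p) * p.-tuple R => vcl M a x.1 x.2).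
Proof. by move=> M0; exact: (measurable_lclass a (mTmax M0)). Qed.

Let ms2 : measurable_fun setT
  (fun x : n1.-tuple (obs R p) * p.-tuple R => (fun=> s) x.1 x.2).
Proof. exact: (measurableT_comp ms measurable_snd). Qed.

(** Integrate selection_bound over the event {L1 in B}: empirical contrasts
    become risks and the sum of deviations contributes at most P(L1 in B). *)
Lemma oracle_ae (M : {set 'I_p}) a : (0 < #|M|)%N ->
  {ae P, forall w, W w <= 2 * risk X Y (vcl M a (L1 w))
    + (2 * lpen M a + 8 / (n2%:R * h) - 2 * risk X Y s)}.
Proof.
move=> M0; have mv := mvcl a M0; have [iF iW mW WF] := condW.
set k := 2 * lpen M a + _ - _.
apply: (@ae_le_comp _ _ _ _ _ P L1 W (fun l => 2 * risk X Y (vcl M a l) + k)) => //.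
- apply: measurable_funD => //; apply: measurable_funM => //.
  exact: measurable_risk.
- apply: RintegrableD => //; last exact: finite_measure_integrable_cst.
  by apply: RintegrableZ => //; exact: integrable_risk.
move=> B mB; have mA : measurable (L1 @^-1` B).
  by rewrite -[X in measurable X]setTI; exact: mL1.
have -> : \int[P]_(w in L1 @^-1` B) W w =
    \int[P]_(w in L1 @^-1` B) loss P X Y s (stilde w).
  by rewrite /Rintegral WF//; exists B => //; rewrite setTI.
set A := L1 @^-1` B in mA *.
have iFA : P.-integrable A (EFin \o (fun w => loss P X Y s (stilde w))).
  exact: integrableS iF.
have icst c : P.-integrable A (EFin \o (fun=> c : R)).
  exact: finite_measure_integrable_cst.
have [ie Es] := integral_empirical ms2 mB.
have [iv Ev] := integral_empirical mv mB.
have [iD ED] : P.-integrable A (EFin \o (fun w => \sum_(M' : {set 'I_p} | (0 < #|M'|)%N)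
    \sum_(a' <- ltrees n1) weight M' a' * deviation (vcl M' a') w)) /\
  \int[P]_(w in A) (\sum_(M' : {set 'I_p} | (0 < #|M'|)%N)
    \sum_(a' <- ltrees n1) weight M' a' * deviation (vcl M' a') w) <= fine (P A).
  have inner (M' : {set 'I_p}) : (0 < #|M'|)%N -> P.-integrable A (EFin \o (fun w =>
      \sum_(a' <- ltrees n1) weight M' a' * deviation (vcl M' a') w)) /\
    \int[P]_(w in A) (\sum_(a' <- ltrees n1) weight M' a' * deviation (vcl M' a') w)
      <= (\sum_(a' <- ltrees n1) weight M' a') * fine (P A).
    move=> M'0; have idev a' := integral_deviation (mvcl a' M'0) mB.
    have [iS ES] := @Rintegral_sum _ _ _ P A _ (ltrees n1) predT
      (fun a' w => weight M' a' * deviation (vcl M' a') w) mA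
      (fun a' _ => RintegrableZ (weight M' a') mA (idev a').1).
    split=> //; rewrite ES mulr_suml; apply: ler_sum => a' _.
    rewrite RintegralZl//; last exact: (idev a').1.
    by rewrite ler_wpM2l ?expR_ge0//; exact: (idev a').2.
  have [iS ES] := @Rintegral_sum _ _ _ P A _ (index_enum {set 'I_p})
    (fun M' : {set 'I_p} => (0 < #|M'|)%N) (fun M' w =>
      \sum_(a' <- ltrees n1) weight M' a' * deviation (vcl M' a') w) mA
    (fun M' M'0 => (inner M' M'0).1).
  split=> //; rewrite ES.
  apply: (@le_trans _ _ (\sum_(M' : {set 'I_p} | (0 < #|M'|)%N)
    (\sum_(a' <- ltrees n1) weight M' a') * fine (P A))).
    by apply: ler_sum => M' M'0; exact: (inner M' M'0).2.
  rewrite -mulr_suml -[leRHS]mul1r ler_wpM2r ?fine_ge0//.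
  exact: sum_weight_le.
rewrite [leRHS]RintegralD//; last by apply: RintegrableZ => //; exact: integrable_risk.
rewrite RintegralZl//; last exact: integrable_risk.
rewrite -Ev Rintegral_cst//.
have LE : \int[P]_(w in A) (loss P X Y s (stilde w) + 2 * empirical_contrast (L2 w) s)
  <= \int[P]_(w in A) (2 * empirical_contrast (L2 w) (vcl M a (L1 w)) + (2 * lpen M a +
  8 / (n2%:R * h) * \sum_(M' : {set 'I_p} | (0 < #|M'|)%N)
    \sum_(a' <- ltrees n1) weight M' a' * deviation (vcl M' a') w)).
  apply: le_Rintegral => //.
  - by apply: RintegrableD => //; apply: RintegrableZ.
  - apply: RintegrableD => //; first by apply: RintegrableZ.
    by apply: RintegrableD => //; apply: RintegrableZ.
  - by move=> w _; exact: selection_bound.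
set S := fun w => \sum_(M' : {set 'I_p} | (0 < #|M'|)%N)
  \sum_(a' <- ltrees n1) weight M' a' * deviation (vcl M' a') w in iD ED LE.
move: LE; rewrite [leLHS]RintegralD//; last by apply: RintegrableZ.
rewrite [X in _ + X <= _](@RintegralZl _ _ _ P A
  (fun w => empirical_contrast (L2 w) s) 2 mA ie) Es Rintegral_cst// -/A.
rewrite [leRHS](_ : _ = 2 * (\int[P]_(w in A)
    empirical_contrast (L2 w) (vcl M a (L1 w))) + (2 * lpen M a * fine (P A) +
    8 / (n2%:R * h) * \int[P]_(w in A) S w)); last first.
  have iZ : P.-integrable A (EFin \o (fun w => 8 / (n2%:R * h) * S w)).
    exact: RintegrableZ.
  rewrite RintegralD//; last 2 first.
  - by apply: RintegrableZ.
  - by apply: RintegrableD.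
  congr (_ + _); first exact: RintegralZl.
  by rewrite RintegralD//; congr (_ + _); [exact: Rintegral_cst|exact: RintegralZl].
have c0 : 0 < 8 / (n2%:R * h) by rewrite divr_gt0// mulr_gt0.
have : 8 / (n2%:R * h) * \int[P]_(w in A) S w <= 8 / (n2%:R * h) * fine (P A).
  by rewrite ler_pM2l.
rewrite /k; set DD := \int[P]_(w in A) S w; set F := \int[P]_(w in A) loss _ _ _ _ _.
set E := \int[P]_(w in A) empirical_contrast _ _.
set c := 8 / _; set cDD := c * DD; lra.
Qed.

Lemma oracle_inequality :
  {ae P, forall w,
     W w <= 2 * inf [set inf [set loss P X Y s u | u in classifiers MT.2]
                          + pen alpha beta h n2 MT | MT in Models (L1 w)]
            + 8 * (1 / (n2%:R * h))}.
Proof.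
have H : {ae P, forall w, forall (M : {set 'I_p}) (i : 'I_(size (ltrees n1))),
  (0 < #|M|)%N ->
  W w <= 2 * risk X Y (vcl M (nth (LLeaf true) (ltrees n1) i) (L1 w))
    + (2 * lpen M (nth (LLeaf true) (ltrees n1) i)
       + 8 / (n2%:R * h) - 2 * risk X Y s)}.
  apply: filter_forall => M; apply: filter_forall => i.
  have [M0|M0] := boolP (0 < #|M|)%N; last exact: nearW.
  by apply: filterS (oracle_ae (nth (LLeaf true) (ltrees n1) i) M0) => w + _.
apply: filterS H => w H.
have {}H (M : {set 'I_p}) a : (0 < #|M|)%N -> a \in ltrees n1 ->
    W w <= 2 * risk X Y (vcl M a (L1 w)) +
           (2 * lpen M a + 8 / (n2%:R * h) - 2 * risk X Y s).
  move=> M0 an1.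
  have ai : (index a (ltrees n1) < size (ltrees n1))%N by rewrite index_mem.
  by have := H M (Ordinal ai) M0; rewrite /= nth_index.
rewrite -lerBlDr -ler_pdivrMl//.
apply: lb_le_inf.
  by eexists; exists (MThat (L1 w) (L2 w)) => //; have [] := MThatP (L1 w) (L2 w).
move=> _ [MT MTin <-]; rewrite -lerBlDr.
apply: lb_le_inf.
  by eexists; exists (shat MT (L2 w)) => //; have [] := shatP (L2 w) MTin.
move=> _ [u uT <-]; have [a an1 [-> ->]] := models_lclass MTin uT.
have M0 : (0 < #|MT.1|)%N by case: MTin.
have := H _ _ M0 an1; rewrite lossE div1r; set c := (n2%:R * h)^-1; lra.
Qed.

End Penalty.

End Oracle.

Theorem proposition1 (R : realType) :
  exists alpha0 beta0 : R, 0 < alpha0 /\ 0 < beta0 /\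
  forall alpha beta : R, alpha0 < alpha -> beta0 < beta ->
  exists C1 C2 : R, 1 < C1 /\ 0 < C2 /\
  forall (p n1 n2 n3 : nat) (d : measure_display) (Omega : measurableType d)
    (P : probability Omega R)
    (X : {RV P >-> p.-tuple R}) (Y : {RV P >-> bool})
    (eta : p.-tuple R -> R) (h : R)
    (D : 'I_n1 + 'I_n2 + 'I_n3 -> {RV P >-> obs R p})
    (phi : R -> R)
    (Tmax : {set 'I_p} -> n1.-tuple (obs R p) -> ctree R p)
    (shat : {set 'I_p} * ctree R p -> n2.-tuple (obs R p) ->
            p.-tuple R -> bool)
    (MThat : n1.-tuple (obs R p) -> n2.-tuple (obs R p) ->
             {set 'I_p} * ctree R p),
  let s := bayes eta in
  let L1 := fun w => [tuple D (inl (inl i)) w | i < n1] in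
  let L2 := fun w => [tuple D (inl (inr i)) w | i < n2] in
  let Models := fun l1 => models (Tmax ^~ l1) in
  let stilde := fun w => shat (MThat (L1 w) (L2 w)) (L2 w) in
  (0 < n2)%N ->
  (* eta(x) = E[Y | X = x] *)
  measurable_fun setT eta ->
  is_cond_exp P X (fun w => (Y w)%:R) (eta \o X) ->
  (* margin condition *)
  0 < h -> (forall x, h <= `|2 * eta x - 1|) ->
  (* independent copies of (X, Y) *)
  independent_family P (fun i => D i : Omega -> obs R p) ->
  (forall i, same_law P (D i) (fun w => (X w, Y w))) ->
  (* maximal CART trees *)
  impurity_function phi ->
  (forall (M : {set 'I_p}) (l1 : n1.-tuple (obs R p)), (0 < #|M|)%N -> maximal_tree phi M l1 (Tmax M l1)) ->
  (forall M : {set 'I_p}, (0 < #|M|)%N -> measurable_tree (Tmax M)) ->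
  (* empirical minimizers and selected model *)
  (forall l1 l2 MT, Models l1 MT ->
     is_argmin (classifiers MT.2) (empirical_contrast l2) (shat MT l2)) ->
  (forall l1 l2,
     is_argmin (Models l1)
       (fun MT => empirical_contrast l2 (shat MT l2)
                  + pen alpha beta h n2 MT)
       (MThat l1 l2)) ->
  forall W : Omega -> R,
  is_cond_exp P L1 (fun w => loss P X Y s (stilde w)) W ->
  {ae P, forall w,
     W w <= C1 * inf [set inf [set loss P X Y s u | u in classifiers MT.2]
                          + pen alpha beta h n2 MT | MT in Models (L1 w)]
            + C2 * (1 / (n2%:R * h))}.
Proof.
exists 12, 8; do 2 split=> //; move=> alpha beta /ltW alpha12 /ltW beta8.
exists 2, 8; split; first by rewrite ltr1n.
split=> // p n1 n2 n3 d Omega P X Y eta h D phi Tmax shat MThat.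
move=> s L1 L2 Models stilde n2_gt0 meta condY h0 margin indD lawD _ maxT mTmax.
move=> shatP MThatP W condW.
exact: (oracle_inequality n2_gt0 meta condY h0 margin indD lawD mTmax alpha12
  beta8 maxT shatP MThatP condW).
Qed.
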